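(* Let $d>2$ and let $K:\mathbb{S}^{d-1}\times\mathbb{S}^{d-1}\to\mathbb{C}$ be a continuous positive definite kernel of the form $$K(\xi,\zeta)=\sum_{j=0}^{\infty}\sum_{k=1}^{N_{j,d}}\sum_{k'=1}^{N_{j,d}}d_j(k,k')\,Y_j^k(\xi)\,\overline{Y_j^{k'}(\zeta)},\qquad \xi,\zeta\in\mathbb{S}^{d-1},$$ where, for each $j\ge0$, $Y_j^1,\ldots,Y_j^{N_{j,d}}$ is an orthonormal basis of the space of spherical harmonics of degree $j$. Let $$\mathcal{F}=\{j\in\mathbb{Z}_{\ge0}: D_j=(d_j(k,k'))_{k,k'=1}^{N_{j,d}}\text{ is a positive definite matrix}\}.$$ If $\mathcal{F}$ contains infinitely many even and infinitely many odd numbers, then $K$ is strictly positive definite on $\mathbb{S}^{d-1}$.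
   Context: $\mathbb{S}^{d-1}$ is the unit sphere in $\mathbb{R}^d$; orthonormality is in $L^2(\mathbb{S}^{d-1})$ with the surface measure; $N_{j,d}$ is the dimension of the space of spherical harmonics of degree $j$: $N_{0,d}=1$, $N_{j,d}=\frac{(2j+d-2)(j+d-3)!}{j!(d-2)!}$ for $j\ge1$. A Hermitian kernel $K$ ($K(\xi,\zeta)=\overline{K(\zeta,\xi)}$) is called positive definite (respectively strictly positive definite) if for every finite set $\Xi$ of distinct points the matrix $(K(\xi,\zeta))_{\xi,\zeta\in\Xi}$ is positive semi-definite (respectively positive definite) on $\mathbb{C}^{|\Xi|}$. *)

(* Defs.v *)
From HB Require Import structures.
From mathcomp Require Import all_boot all_order all_algebra.
From mathcomp Require Import all_classical all_reals all_analysis.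
From mathcomp Require Import measurable_realfun.
From mathcomp Require Import sesquilinear complex.
(* The notations of [mpoly] clash with those of MathComp-Analysis. *)
From mathcomp Require Import (canonicals, coercions) mpoly.

Set Implicit Arguments.
Unset Strict Implicit.
Unset Printing Implicit Defensive.
Import Order.TTheory GRing.Theory Num.Theory.
Import numFieldNormedType.Exports.
Local Open Scope classical_set_scope.
Local Open Scope ring_scope.

Section MeasurableRowVector.
Context (R : realType) (n : nat).

Let coord (i : 'I_n) (x : 'rV[R]_n) : measurableTypeR R := x ord0 i.

Let rV_set0 : g_sigma_preimage coord set0.
Proof. exact: sigma_algebra0. Qed.

Let rV_setC A : g_sigma_preimage coord A -> g_sigma_preimage coord (~` A).
Proof. exact: sigma_algebraC. Qed.

Let rV_bigcup (F : (set 'rV[R]_n)^nat) :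
  (forall i, g_sigma_preimage coord (F i)) ->
  g_sigma_preimage coord (\bigcup_i (F i)).
Proof. exact: sigma_algebra_bigcup. Qed.

(* The sigma-algebra generated by the coordinates, i.e. the Borel sets. *)
HB.instance Definition _ := @isMeasurable.Build default_measure_display
  'rV[R]_n (g_sigma_preimage coord) rV_set0 rV_setC rV_bigcup.

Lemma measurable_coord (i : 'I_n) :
  measurable_fun [set: 'rV[R]_n] (fun x => x ord0 i : measurableTypeR R).
Proof.
move=> _ Y mY; rewrite setTI; apply: sub_sigma_algebra => /=.
rewrite -bigcup_seq/=; exists i => /=; first by rewrite mem_index_enum.
by exists Y => //; rewrite setTI.
Qed.

Lemma measurable_to_rV d (T : measurableType d) (f : T -> 'rV[R]_n) :
  (forall i, measurable_fun setT (fun x => f x ord0 i : measurableTypeR R)) ->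
  measurable_fun setT f.
Proof.
move=> mf _ A mA; rewrite setTI; move: A mA.
suff : g_sigma_preimage coord `<=` [set A | measurable (f @^-1` A)] by [].
apply: smallest_sub.
  split => [|A mA|F mF] /=.
  - by rewrite preimage_set0.
  - by rewrite setTD; exact: measurableC.
  - by rewrite preimage_bigcup; by apply: bigcupT_measurable.
rewrite -bigcup_seq; apply: bigcup_sub => i _ A [B mB <-] /=.
by rewrite setTI; have := mf i measurableT B mB; rewrite setTI.
Qed.

End MeasurableRowVector.

Section LebesgueRowVector.
Context (R : realType).

Definition rV_cons n (p : measurableTypeR R * 'rV[R]_n) : 'rV[R]_n.+1 :=
  row_mx (p.1 : R)%:M p.2.

Lemma rV_cons_head n p : @rV_cons n p ord0 ord0 = p.1.
Proof.
have -> : (ord0 : 'I_n.+1) = lshift n (ord0 : 'I_1) by apply: val_inj.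
by apply: etrans (row_mxEl (p.1 : R)%:M p.2 ord0 ord0) _; rewrite mxE.
Qed.

Lemma rV_cons_tail n p j : @rV_cons n p ord0 (lift ord0 j) = p.2 ord0 j.
Proof.
have -> : lift ord0 j = rshift 1 j by apply: val_inj.
exact: (row_mxEr (p.1 : R)%:M p.2 ord0 j).
Qed.

Lemma measurable_rV_cons n : measurable_fun setT (@rV_cons n).
Proof.
apply: measurable_to_rV => i.
case: (unliftP ord0 i) => [j|] ->.
  under eq_fun do rewrite rV_cons_tail.
  exact: (measurableT_comp (measurable_coord j) measurable_snd).
by under eq_fun do rewrite rV_cons_head; exact: measurable_fst.
Qed.

Section step.
Context (n : nat) (mu : {sigma_finite_measure set 'rV[R]_n -> \bar R}).
Local Open Scope ereal_scope.

Definition lebesgue_rV_step : set 'rV[R]_n.+1 -> \bar R :=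
  pushforward (@lebesgue_measure R \x mu) (@rV_cons n).

HB.instance Definition _ := Measure.copy lebesgue_rV_step
  (measure_function_pushforward__canonical__measure_function_Measure
     (@lebesgue_measure R \x mu) (@measurable_rV_cons n)).

Let step_sigma_finite : sigma_finite setT lebesgue_rV_step.
Proof.
pose lam : {sigma_finite_measure set (measurableTypeR R) -> \bar R} :=
  @lebesgue_measure R.
have [F TF Foo] : sigma_finite setT (lam \x mu).
  have /sigma_finiteP[F [TF ndF Foo]] := sigma_finiteT lam.
  have /sigma_finiteP[G [TG ndG Goo]] := sigma_finiteT mu.
  exists (fun i => F i `*` G i).
    rewrite -setXTT TF TG predeqE => -[x y]; split.
      move=> [/= [i _ Fix] [k _ Gky]]; exists (maxn i k) => //; split.
      - by move: x Fix; exact/subsetPset/ndF/leq_maxl.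
      - by move: y Gky; exact/subsetPset/ndG/leq_maxr.
    by move=> [i _ []/= ? ?]; split; exists i.
  move=> k; have [mF Fk] := Foo k; have [mG Gk] := Goo k.
  split; first exact: measurableX.
  by rewrite product_measure1E// lte_mul_pinfty// ge0_fin_numE.
pose g (x : 'rV[R]_n.+1) : measurableTypeR R * 'rV[R]_n :=
  (x ord0 ord0, \row_j x ord0 (lift ord0 j)).
have gK : cancel (@rV_cons n) g.
  move=> [a x]; congr pair; first by rewrite rV_cons_head.
  by apply/rowP => j; rewrite mxE rV_cons_tail.
have mg : measurable_fun setT g.
  apply/measurable_fun_pairP; split; first exact: measurable_coord.
  apply: measurable_to_rV => i; under eq_fun do rewrite mxE.
  exact: measurable_coord.
exists (fun i => g @^-1` F i).
  by rewrite -preimage_bigcup -TF preimage_setT.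
move=> i; have [mF Fi] := Foo i; split.
  by rewrite -[X in measurable X]setTI; exact: mg.
rewrite /lebesgue_rV_step /pushforward -comp_preimage (_ : g \o _ = id)//.
by apply/funext => x /=; rewrite gK.
Qed.

HB.instance Definition _ := Measure_isSigmaFinite.Build _ _ _ lebesgue_rV_step
  step_sigma_finite.

End step.

(* Lebesgue measure on R^n, by recursion as a product measure. *)
Fixpoint lebesgue_rV n : {sigma_finite_measure set 'rV[R]_n -> \bar R} :=
  match n with
  | 0 => dirac (0 : 'rV[R]_0)
  | m.+1 => lebesgue_rV_step (lebesgue_rV m)
  end.

End LebesgueRowVector.

Section SurfaceMeasure.
Context (R : realType) (d : nat).

Definition enorm (x : 'rV[R]_d) : R := Num.sqrt (\sum_(i < d) x ord0 i ^+ 2).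

Definition sphere : set 'rV[R]_d := [set x | enorm x = 1].

Definition eball : set 'rV[R]_d := [set x | enorm x <= 1].

Definition normalize (x : 'rV[R]_d) : 'rV[R]_d := (enorm x)^-1 *: x.

Lemma enormE x : enorm x = (\sum_(i < d) x ord0 i ^+ 2) `^ (2^-1).
Proof. by rewrite powR12_sqrt// sumr_ge0// => i _; exact: sqr_ge0. Qed.

Lemma measurable_enorm : measurable_fun setT (enorm : _ -> measurableTypeR R).
Proof.
rewrite (funext enormE); apply: (measurableT_comp (measurable_powR _)).
apply: measurable_sum => i; apply: measurable_funX; exact: measurable_coord.
Qed.

Lemma measurable_eball : measurable eball.
Proof.
have := measurable_enorm measurableT (measurable_itv `]-oo, 1 : R]).
rewrite setTI (_ : _ @^-1` _ = eball)//.
Qed.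

Lemma measurable_normalize : measurable_fun setT normalize.
Proof.
apply: measurable_to_rV => i; under eq_fun do rewrite mxE.
apply: measurable_funM; last exact: measurable_coord.
rewrite (_ : (fun _ => _) = (fun a => a `^ (-1)) \o @enorm); last first.
  by apply/funext => x /=; rewrite powR_inv1 ?sqrtr_ge0.
exact: (measurableT_comp (measurable_powR _) measurable_enorm).
Qed.

(* The cone formula sigma(A) = d * vol {x : |x| <= 1, x / |x| \in A} for
   the surface measure of A `<=` sphere; the origin is a null set. *)
Definition surface_measure : set 'rV[R]_d -> \bar R :=
  pushforward
    (mscale (d%:R%:nng : {nonneg R})
       (mrestr (lebesgue_rV R d) measurable_eball))
    normalize.

HB.instance Definition _ := Measure.copy surface_measure
  (measure_function_pushforward__canonical__measure_function_Measure
     (mscale (d%:R%:nng : {nonneg R})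
        (mrestr (lebesgue_rV R d) measurable_eball))
     measurable_normalize).

End SurfaceMeasure.

Definition harmonic_dim (d j : nat) : nat :=
  if j == 0%N then 1%N
  else (((2 * j + d - 2) * (j + d - 3)`!) %/ (j`! * (d - 2)`!))%N.

Section SphericalHarmonics.
Context (R : realType) (d : nat).
Local Notation C := R[i].
Implicit Types (f g : 'rV[R]_d -> C).

(* Inner product of L^2(S^(d-1)); the integral of a complex function is taken
   componentwise. *)
Definition sphere_dot f g : C :=
  Complex (\int[@surface_measure R d]_(x in @sphere R d) complex.Re (f x * (g x)^*)%C)
          (\int[@surface_measure R d]_(x in @sphere R d) complex.Im (f x * (g x)^*)%C).

Definition mlaplacian (p : mpoly.mpoly d C) : mpoly.mpoly d C :=
  \sum_(i < d) mpoly.mderiv i (mpoly.mderiv i p).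

(* Functions on the sphere are represented by total functions on R^d of which
   only the values on the sphere matter. *)
Definition spherical_harmonic (j : nat) f : Prop :=
  exists p : mpoly.mpoly d C,
    [/\ p \is mpoly.ishomog1 j mpoly.mdeg,
        mlaplacian p = 0 &
        forall x, sphere x ->
          f x = mpoly.meval (fun i => (x ord0 i)%:C%C) p].

Definition orthonormal_harmonic_basis (j : nat)
    (Y : 'I_(harmonic_dim d j) -> 'rV[R]_d -> C) : Prop :=
  [/\ forall k, spherical_harmonic j (Y k),
      forall k k', sphere_dot (Y k) (Y k') = (k == k')%:R &
      forall f, spherical_harmonic j f ->
        exists c : 'I_(harmonic_dim d j) -> C,
          forall x, sphere x -> f x = \sum_k c k * Y k x].

Definition harmonic_partial_sum
    (Y : forall j, 'I_(harmonic_dim d j) -> 'rV[R]_d -> C)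
    (D : forall j, 'M[C]_(harmonic_dim d j)) (n : nat) (x y : 'rV[R]_d) : C :=
  \sum_(j < n) \sum_k \sum_k' D j k k' * Y j k x * ((Y j k' y)^*)%C.

(* K is the sum of the series in L^2(S^(d-1) x S^(d-1)), where the functions
   Y_j^k(x) conj(Y_l^k'(y)) are orthonormal. For K continuous and positive
   definite the series then also converges to K absolutely and uniformly, by
   Mercer's theorem. *)
Definition harmonic_expansion (K : 'rV[R]_d -> 'rV[R]_d -> C)
    (Y : forall j, 'I_(harmonic_dim d j) -> 'rV[R]_d -> C)
    (D : forall j, 'M[C]_(harmonic_dim d j)) : Prop :=
  (\int[@surface_measure R d]_(x in @sphere R d)
     \int[@surface_measure R d]_(y in @sphere R d)
       (ComplexField.Normc.normc (K x y - harmonic_partial_sum Y D n x y) ^+ 2)%:E)%E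
    @[n --> \oo] --> 0%E.

End SphericalHarmonics.

Section PositiveDefinite.
Context (R : realType).
Local Notation C := R[i].

(* In R[i], [0 <= z] (resp. [0 < z]) means that z is real and nonnegative
   (resp. positive). *)
Definition psd_mx n (A : 'M[C]_n) : Prop :=
  A \is hermsymmx /\
  forall c : 'cV[C]_n, 0 <= (map_mx Num.conj c^T *m A *m c) ord0 ord0.

Definition pd_mx n (A : 'M[C]_n) : Prop :=
  A \is hermsymmx /\
  forall c : 'cV[C]_n, c != 0 -> 0 < (map_mx Num.conj c^T *m A *m c) ord0 ord0.

Context (d : nat).
Implicit Types K : 'rV[R]_d -> 'rV[R]_d -> C.

Definition hermitian_kernel K : Prop :=
  forall x y, sphere x -> sphere y -> K x y = ((K y x)^*)%C.

Definition kernel_mx K n (x : 'I_n -> 'rV[R]_d) : 'M[C]_n :=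
  \matrix_(i, j) K (x i) (x j).

Definition positive_definite_kernel K : Prop :=
  hermitian_kernel K /\
  forall n (x : 'I_n -> 'rV[R]_d), injective x -> (forall i, sphere (x i)) ->
    psd_mx (kernel_mx K x).

Definition strictly_positive_definite_kernel K : Prop :=
  hermitian_kernel K /\
  forall n (x : 'I_n -> 'rV[R]_d), injective x -> (forall i, sphere (x i)) ->
    pd_mx (kernel_mx K x).

Definition continuous_kernel K : Prop :=
  {within @sphere R d `*` @sphere R d,
    continuous (fun p : 'rV[R]_d * 'rV[R]_d => K p.1 p.2 : C^o)}.

End PositiveDefinite.

(* Main.v *)
(** If [c] is a null vector of the kernel matrix at x_1, ..., x_n, then
    sum_i conj(c_i) K(x_i, .) vanishes on the sphere, by Cauchy-Schwarz for
    the semidefinite form K. Integrating against Y_j^k' turns this into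
    sum_k w_k d_j(k, k') = 0 with w_k = sum_i conj(c_i) Y_j^k(x_i), so for j in
    F the functional f |-> sum_i conj(c_i) f(x_i) kills every spherical
    harmonic of degree j. It is tested on f(x) = (u.x)^j with u = a + i b,
    where a = x_1 and b is a unit vector orthogonal to a such that the great
    circle through a and b meets the x_i only in a and possibly -a: as u.u = 0,
    f is harmonic, f(x_1) = 1, f(-x_1) = (-1)^j, and |u.x_i| < 1 for the other
    points. Letting j tend to infinity through the even and the odd elements
    of F gives c_1 = 0.

    Only convergence in L^2 is known, which determines the coefficients of
    K(x, .) for almost every x, hence for every x by continuity. Their
    computation uses the orthogonality of harmonics p, q of different degrees,
    which follows from the divergence theorem on the ball for
    W(|x|^2) (p grad q - q grad p) with W(1) = 0. *)

Require Import Defs.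
From mathcomp Require Import all_boot all_order all_algebra.
From mathcomp Require Import all_classical all_reals all_analysis.
From mathcomp Require Import measurable_realfun.
From mathcomp Require Import ring lra.
From mathcomp Require Import sesquilinear complex.
From mathcomp Require Import (canonicals, coercions) mpoly.

Set Implicit Arguments.
Unset Strict Implicit.
Unset Printing Implicit Defensive.
Import Order.TTheory GRing.Theory Num.Theory.
Import numFieldNormedType.Exports.
Local Open Scope classical_set_scope.
Local Open Scope ring_scope.

(** * Lebesgue measure on row vectors *)

Section LebesgueRV.
Context (R : realType).

Lemma rV_ballP n (c x : 'rV[R]_n) (e : R) : 0 < e ->
  ball c e x <-> forall i, `|c ord0 i - x ord0 i| < e.
Proof.
move=> e0; split=> [[_ h] i|h]; first exact: h.
by split => // i j; rewrite ord1; exact: h.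
Qed.

Lemma measurable_rV_ball n (c : 'rV[R]_n) (e : R) : 0 < e ->
  measurable (ball c e).
Proof.
move=> e0.
have -> : ball c e = \bigcap_(i in [set: 'I_n]) 
   ((fun x : 'rV[R]_n => x ord0 i) @^-1` ball (c ord0 i) e).
  apply/seteqP; split => [x /rV_ballP-/(_ e0) h i _|x h]; first exact: h.
  by apply/rV_ballP => // i; exact: h.
apply: fin_bigcap_measurable => // i _.
rewrite -[X in measurable X]setTI; apply: (measurable_coord i) => //.
exact: measurable_ball.
Qed.

(** Balls of row vectors are cubes for the sup norm, so the preimage of one under [rV_cons] is an
    interval times a cube of one dimension less. *)
Lemma lebesgue_rV_ball n (c : 'rV[R]_n) (e : R) : 0 < e ->
  (lebesgue_rV R n (ball c e) = ((e *+ 2) ^+ n)%:E)%E.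
Proof.
move=> e0; elim: n c => [|n IH] c.
  rewrite /= diracE mem_set ?expr0// .
  by apply/rV_ballP => // -[].
rewrite /= /lebesgue_rV_step /pushforward.
have -> : @rV_cons R n @^-1` ball c e =
   ball (c ord0 ord0) e `*` ball (\row_j c ord0 (lift ord0 j) : 'rV[R]_n) e.
  apply/seteqP; split => [[a x] /= /rV_ballP-/(_ e0) h|[a x] [/= h1 /rV_ballP-/(_ e0) h2]].
    split => /=; first by have := h ord0; rewrite rV_cons_head.
    by apply/rV_ballP => // j; have := h (lift ord0 j); rewrite rV_cons_tail mxE.
  apply/rV_ballP => // i; case: (unliftP ord0 i) => [j|] ->.
    by rewrite rV_cons_tail; have := h2 j; rewrite mxE.
  by rewrite rV_cons_head.
rewrite product_measure1E ?IH//; last 2 first.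
- exact: measurable_ball.
- exact: measurable_rV_ball.
by rewrite [X in (X * _)%E](lebesgue_measure_ball (c ord0 ord0) (ltW e0)) -EFinM exprS.
Qed.

(** Measurable sets are generated by the coordinates; an open set is the countable union of the
    cubes with rational centre and radius 1/(N+1) that it contains. *)
Lemma open_measurable_rV n (U : set 'rV[R]_n) : open U -> measurable U.
Proof.
move=> oU.
pose q (p : 'rV[rat]_n * nat) : set 'rV[R]_n :=
  ball (map_mx ratr p.1 : 'rV[R]_n) (p.2.+1%:R^-1).
have -> : U = \bigcup_(p in [set p | q p `<=` U]) q p.
  apply/seteqP; split => [x Ux|x [p /= h /h//]].
  have /nbhs_ballP[e /= e0 eU] : nbhs x U by apply: open_nbhs_nbhs.
  (* With a radius below e/2, a cube whose centre lies within that radius of x contains x and stays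
     inside the ball of radius e. *)
  have [N Ne] : exists N : nat, N.+1%:R^-1 < e / 2.
    have e20 : 0 < e / 2 by rewrite divr_gt0.
    have [N _ /(_ N (leqnn N)) h] := near_infty_natSinv_lt (PosNum e20).
    by exists N.
  have N0 : 0 < N.+1%:R^-1 :> R by rewrite invr_gt0.
  pose eta : R := N.+1%:R^-1; rewrite -/eta in N0 Ne.
  have /choice[r hr] i : exists r : rat,
      ratr r \in `](x ord0 i - eta), (x ord0 i + eta)[.
    have /rat_in_itvoo[r ?] : x ord0 i - eta < x ord0 i + eta by lra.
    by exists r.
  have rx i : `|(map_mx ratr (\row_i r i) : 'rV[R]_n) ord0 i - x ord0 i| < eta.
    rewrite !mxE; have := hr i; rewrite in_itv/= ltr_norml => /andP[? ?].
    by apply/andP; split; lra.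
  exists (\row_i r i, N); last exact/rV_ballP.
  move=> y /= /rV_ballP-/(_ N0) h; apply: eU; apply/rV_ballP => // i.
  have := h i; have := rx i; rewrite -/eta !ltr_norml => /andP[? ?] /andP[? ?].
  by apply/andP; split; lra.
rewrite bigcup_mkcond; apply: countable_bigcupT_measurable => [|p]; first exact: countableP.
by case: ifPn => // _; apply: measurable_rV_ball; rewrite invr_gt0.
Qed.

Lemma continuous_measurable_rV n (D : set 'rV[R]_n) (f : 'rV[R]_n -> R) :
  measurable D -> {within D, continuous f} -> measurable_fun D (f : _ -> measurableTypeR R).
Proof.
move=> mD cf.
apply: (measurability _ (RGenOpens.measurableE R)).
move=> _ [_ [a [b ->]] <-].
have [V oV VD] := (@open_subspaceP _ D _).1
  ((@continuousP (subspace D) R f).1 cf _ (@interval_open R (BRight a) (BLeft b) isT isT)).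
by rewrite setIC -VD; apply: measurableI => //; exact: open_measurable_rV.
Qed.

Lemma bounded_support_integrable d (T : measurableType d)
    (mu : {measure set T -> \bar R}) (A : set T) (f : T -> R) (M : R) :
  measurable A -> (mu A < +oo)%E -> measurable_fun setT f ->
  (forall x, `|f x| <= M) -> (forall x, ~ A x -> f x = 0) ->
  mu.-integrable setT (EFin \o f).
Proof.
move=> mA Afin mf fM f0.
have -> : EFin \o f = (EFin \o f) \_ A.
  apply/funext => x; rewrite /patch; case: ifPn => //= xA.
  by rewrite f0//; move: xA => /negP; rewrite in_setE.
apply/(integrable_mkcond _ mA).
apply: measurable_bounded_integrable => //.
- exact: measurable_funTS.
- by exists M; split; [exact: num_real|move=> y My x _; exact: le_trans (ltW My)].
Qed.

(** As t varies, this runs through the line through x parallel to the i-th axis. *)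
Definition updrV n (x : 'rV[R]_n) (i : 'I_n) (t : R) : 'rV[R]_n :=
  \row_j if j == i then t else x ord0 j.

Lemma updrV_rV_cons0 n (a t : R) (x : 'rV[R]_n) :
  updrV (rV_cons (a, x)) ord0 t = rV_cons (t, x).
Proof.
apply/rowP => j; rewrite mxE; case: (unliftP ord0 j) => [k|] ->.
  by rewrite !rV_cons_tail.
by rewrite eqxx rV_cons_head.
Qed.

Lemma updrV_rV_consS n (a t : R) (x : 'rV[R]_n) i :
  updrV (rV_cons (a, x)) (lift ord0 i) t = rV_cons (a, updrV x i t).
Proof.
apply/rowP => j; rewrite mxE; case: (unliftP ord0 j) => [k|] ->.
  rewrite !rV_cons_tail /= mxE; case: eqVneq => [/lift_inj->|/negbTE ki].
    by rewrite eqxx.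
  by case: eqVneq => // kj; rewrite kj eqxx in ki.
by rewrite !rV_cons_head (negbTE (neq_lift _ _)).
Qed.

(* Slicing in an arbitrary coordinate direction is Fubini's theorem, by
   induction along the recursive definition of [lebesgue_rV]. *)
Lemma integral_lebesgue_rV_slice0 n (i : 'I_n) (f : 'rV[R]_n -> R) (M r : R) :
  0 < r -> measurable_fun setT (f : _ -> measurableTypeR R) ->
  (forall x, `|f x| <= M) -> (forall x, ~ ball 0 r x -> f x = 0) ->
  (forall x, \int[@lebesgue_measure R]_t (f (updrV x i t))%:E = 0)%E ->
  (\int[lebesgue_rV R n]_x (f x)%:E = 0)%E.
Proof.
move=> r0; elim: n i f => [[]//|n IH] i f mf fM f0 fi /=.
have mfc : measurable_fun setT (f \o @rV_cons R n : _ -> measurableTypeR R).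
  exact: (measurableT_comp mf (measurable_rV_cons (R := R) (n:=n))).
pose B := @rV_cons R n @^-1` ball 0 r.
have mB : measurable B.
  by rewrite -[B]setTI; apply: measurable_rV_cons => //; exact: measurable_rV_ball.
have int : (@lebesgue_measure R \x lebesgue_rV R n)%E.-integrable setT
    (EFin \o (f \o @rV_cons R n)).
  apply: (bounded_support_integrable (A := B) (M := M)) => //.
  - have := @lebesgue_rV_ball n.+1 0 r r0.
    by rewrite /= /lebesgue_rV_step /pushforward -/B => ->; rewrite ltry.
  - by move=> x; exact: fM.
  - by move=> x nB; rewrite /= f0.
rewrite (integral_pushforward (@measurable_rV_cons R n)) ?preimage_setT//;
  last exact/measurable_EFinP.
case: (unliftP ord0 i) fi => [j|] -> fi.
  rewrite -integral12_prod_meas1//=.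
  rewrite integral0_eq// => a _.
  apply: (IH j (fun x => f (rV_cons (a, x)))) => [|x|x nx|x].
  - apply: (measurableT_comp mfc); exact: measurable_pair1.
  - exact: fM.
  - apply: f0 => /rV_ballP-/(_ r0) h; apply: nx; apply/rV_ballP => // k.
    by have := h (lift ord0 k); rewrite rV_cons_tail !mxE.
  - rewrite -[RHS](fi (rV_cons (a, x))).
    by under [RHS]eq_integral do rewrite updrV_rV_consS.
(* The slicing coordinate is now the head, so the head is integrated first, in the other order of
   Fubini's theorem. *)
rewrite -integral21_prod_meas1//=.
rewrite integral0_eq// => x _.
rewrite -[RHS](fi (rV_cons (0, x))).
by under [RHS]eq_integral do rewrite updrV_rV_cons0.
Qed.

End LebesgueRV.

(** * Polynomials on the unit ball *)

Section ContinuousOperations.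
Context (R : realType) (T : topologicalType).
Implicit Types f g : T -> R.

Lemma continuous_addf f g :
  continuous f -> continuous g -> continuous (fun x => f x + g x).
Proof. by move=> cf cg x; exact: (cvgD (cf x) (cg x)). Qed.

Lemma continuous_mulf f g :
  continuous f -> continuous g -> continuous (fun x => f x * g x).
Proof. by move=> cf cg x; exact: (cvgM (cf x) (cg x)). Qed.

Lemma continuous_expf n f : continuous f -> continuous (fun x => f x ^+ n).
Proof.
move=> cf; elim: n => [|n IH]; first exact: cst_continuous.
by under eq_fun do rewrite exprS; exact: continuous_mulf.
Qed.

Lemma continuous_sumf (I : finType) (F : I -> T -> R) :
  (forall i, continuous (F i)) -> continuous (fun x => \sum_i F i x).
Proof.
move=> cF; elim: (index_enum _) => [|i r IH].
  by under eq_fun do rewrite big_nil; exact: cst_continuous.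
by under eq_fun do rewrite big_cons; exact: continuous_addf.
Qed.

Lemma continuous_prodf (I : finType) (F : I -> T -> R) :
  (forall i, continuous (F i)) -> continuous (fun x => \prod_i F i x).
Proof.
move=> cF; elim: (index_enum _) => [|i r IH].
  by under eq_fun do rewrite big_nil; exact: cst_continuous.
by under eq_fun do rewrite big_cons; exact: continuous_mulf.
Qed.

End ContinuousOperations.

Section PolynomialFunctions.
Context (R : realType) (d : nat).
Implicit Types (p q : mpoly.mpoly d R) (x : 'rV[R]_d).

Definition pfun p x : R := mpoly.meval (fun i => x ord0 i) p.

Lemma pfunZX c (m : mpoly.multinom d) p x :
  pfun (c *: mpoly.mpolyX R m + p) x =
  c * \prod_(i < d) x ord0 i ^+ m i + pfun p x.
Proof. by rewrite /pfun mpoly.mevalD mpoly.mevalZ mpoly.mevalX. Qed.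

Lemma continuous_pfun p : continuous (pfun p).
Proof.
elim/mpoly.mpolyind: p => [|c m p _ _ IH].
  have -> : pfun 0 = fun=> 0 by apply/funext => x; rewrite /pfun mpoly.meval0.
  exact: cst_continuous.
rewrite (funext (pfunZX c m p)).
apply: continuous_addf => //; apply: continuous_mulf; first exact: cst_continuous.
apply: continuous_prodf => i; apply: continuous_expf; exact: coord_continuous.
Qed.

Lemma prod_updrV (m : mpoly.multinom d) x i t :
  \prod_(k < d) updrV x i t ord0 k ^+ m k =
  t ^+ m i * \prod_(k < d | k != i) x ord0 k ^+ m k.
Proof.
rewrite (bigD1 i)//= mxE eqxx; congr (_ * _).
by apply: eq_bigr => k /negbTE ki; rewrite mxE ki.
Qed.

Lemma is_derive_pfun p x i (t : R) :
  is_derive t 1 (fun t => pfun p (updrV x i t))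
    (pfun (mpoly.mderiv i p) (updrV x i t)).
Proof.
elim/mpoly.mpolyind: p => [|c m p _ _ IH].
  rewrite (_ : (fun _ => _) = cst 0); last first.
    by apply/funext => s; rewrite /pfun mpoly.meval0.
  by rewrite mpoly.mderiv0 /pfun mpoly.meval0; exact: is_derive_cst.
under eq_fun do rewrite pfunZX prod_updrV.
rewrite mpoly.mderivD mpoly.mderivZ mpoly.mderivX scalerA pfunZX prod_updrV.
apply: is_deriveD.
set C := \prod_(k < d | k != i) x ord0 k ^+ m k.
have -> : (fun t => c * (t ^+ m i * C)) = horner ((c * C) *: 'X^(m i)).
  by apply/funext => s; rewrite hornerZ hornerXn; ring.
apply: is_derive_eq.
rewrite derivZ derivXn hornerZ hornerMn hornerXn mpoly.mnmBE mpoly.mnm1E eqxx subn1.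
rewrite -mulr_natr; suff -> : \prod_(k < d | k != i)
    x ord0 k ^+ mpoly.fun_of_multinom (mpoly.mnm_sub m (mpoly.mnm1 i)) k = C by ring.
apply: eq_bigr => k ki; rewrite mpoly.mnmBE mpoly.mnm1E eq_sym (negbTE ki).
by rewrite subn0.
Qed.

Lemma pfun_scale j p (a : R) x : p \is mpoly.ishomog1 j mpoly.mdeg ->
  pfun p (a *: x) = a ^+ j * pfun p x.
Proof.
move/mpoly.dhomogP => hp; rewrite /pfun !mpoly.mevalE mulr_sumr !big_seq.
apply: eq_bigr => m /hp /= <-.
under eq_bigr do rewrite mxE exprMn.
by rewrite big_split/= mpoly.mdegE prodrXr; ring.
Qed.

Lemma pfunE p x :
  pfun p x = \sum_(m <- mpoly.msupp p) mpoly.mcoeff m p * \prod_i x ord0 i ^+ m i.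
Proof. exact: mpoly.mevalE. Qed.

Lemma pfun_mderivX (m : mpoly.multinom d) i x :
  x ord0 i * pfun (mpoly.mderiv i (mpoly.mpolyX R m)) x =
  (m i)%:R * \prod_k x ord0 k ^+ m k.
Proof.
rewrite mpoly.mderivX /pfun mpoly.mevalZ mpoly.mevalX mulrCA.
(* If m i = 0, the truncated exponent m i - 1 is wrong, but the factor m i removes the term. *)
case mi : (m i) => [|n]; first by rewrite !mul0r.
congr (_ * _); rewrite (bigD1 i)//= [RHS](bigD1 i)//= mulrA.
rewrite mpoly.mnmBE mpoly.mnm1E eqxx mi subn1 exprS; congr (_ * _).
apply: eq_bigr => k ki; rewrite mpoly.mnmBE mpoly.mnm1E eq_sym (negbTE ki).
by rewrite subn0.
Qed.

Lemma pfun_euler j p x : p \is mpoly.ishomog1 j mpoly.mdeg ->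
  \sum_(i < d) x ord0 i * pfun (mpoly.mderiv i p) x = j%:R * pfun p x.
Proof.
move=> /mpoly.dhomogP hp; rewrite pfunE mulr_sumr.
transitivity (\sum_(i < d) \sum_(m <- mpoly.msupp p)
    mpoly.mcoeff m p * ((m i)%:R * \prod_k x ord0 k ^+ m k)).
  apply: eq_bigr => i _.
  rewrite {1}[p]mpoly.mpolyE raddf_sum /pfun raddf_sum mulr_sumr/=.
  apply: eq_bigr => m _; rewrite linearZ /= mpoly.mevalZ mulrCA.
  by rewrite -/(pfun _ x) pfun_mderivX.
rewrite exchange_big/= !big_seq; apply: eq_bigr => m /hp /= <-.
by rewrite -mulr_sumr -mulr_suml mpoly.mdegE natr_sum; ring.
Qed.

End PolynomialFunctions.

(** * Weighted orthogonality on the ball by the divergence theorem *)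

Section BallOrthogonality.
Context (R : realType) (d : nat).
Implicit Types (p q : mpoly.mpoly d R) (x : 'rV[R]_d).

Definition sqnorm x : R := \sum_(i < d) x ord0 i ^+ 2.

Lemma sqnorm_ge0 x : 0 <= sqnorm x.
Proof. by apply: sumr_ge0 => i _; exact: sqr_ge0. Qed.

Lemma continuous_sqnorm : continuous sqnorm.
Proof.
by apply: continuous_sumf => i; apply: continuous_expf; exact: coord_continuous.
Qed.

Lemma eballE x : eball x <-> sqnorm x <= 1.
Proof.
rewrite /eball /= /enorm -/(sqnorm x) -[X in _ <= X]sqrtr1.
by rewrite ler_psqrt ?nnegrE ?sqnorm_ge0.
Qed.

Lemma sqnorm_coord_le x i : `|x ord0 i| ^+ 2 <= sqnorm x.
Proof.
rewrite real_normK ?num_real// /sqnorm (bigD1 i)//= lerDl.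
by apply: sumr_ge0 => k _; exact: sqr_ge0.
Qed.

Lemma eball_sub_ball : @eball R d `<=` ball 0 2.
Proof.
move=> x /eballE x1; apply/rV_ballP => // i; rewrite mxE sub0r normrN.
have : `|x ord0 i| ^+ 2 <= 1 ^+ 2.
  by rewrite expr1n (le_trans (sqnorm_coord_le x i)).
rewrite ler_pXn2r ?nnegrE//; lra.
Qed.

Lemma closed_eball : closed (@eball R d).
Proof.
have -> : @eball R d = sqnorm @^-1` [set s | s <= 1].
  by apply/seteqP; split => x /eballE.
by apply: closed_comp; [move=> x _; exact: continuous_sqnorm|exact: closed_le].
Qed.

Lemma compact_eball : compact (@eball R d).
Proof.
apply: bounded_closed_compact; last exact: closed_eball.
exists 2; split => // M M2 x /eball_sub_ball.
rewrite mx_norm_ball /ball_ /= sub0r normrN => /ltW h.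
by apply: le_trans h (ltW M2).
Qed.

Lemma sqnorm_updrV x i t :
  sqnorm (updrV x i t) = t ^+ 2 + \sum_(k < d | k != i) x ord0 k ^+ 2.
Proof.
rewrite /sqnorm (bigD1 i)//= mxE eqxx; congr (_ + _).
by apply: eq_bigr => k /negbTE ki; rewrite mxE ki.
Qed.

Lemma continuous_updrV x i : continuous (updrV x i).
Proof.
move=> t; apply/cvg_ballP => e e0; near=> s.
apply/rV_ballP => // j; rewrite !mxE; case: eqP => _; last by rewrite subrr normr0.
by near: s; exact: (nbhsx_ballx (t : R) e e0).
Unshelve. all: by end_near. Qed.

Lemma eball_slice x i t : let c := \sum_(k < d | k != i) x ord0 k ^+ 2 in
  c <= 1 -> eball (updrV x i t) <-> t \in `[- Num.sqrt (1 - c), Num.sqrt (1 - c)].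
Proof.
move=> c c1; rewrite in_itv/= -ler_norml -(@ler_pXn2r _ 2)// ?nnegrE ?sqrtr_ge0//.
rewrite sqr_sqrtr ?subr_ge0// real_normK ?num_real//.
by rewrite eballE sqnorm_updrV -/c lerBrDr.
Qed.

Lemma is_derive_sqnorm x i (t : R) :
  is_derive t 1 (fun t => sqnorm (updrV x i t)) (2 * updrV x i t ord0 i).
Proof.
under eq_fun do rewrite sqnorm_updrV.
set c := \sum_(k < d | k != i) x ord0 k ^+ 2.
have -> : (fun t => t ^+ 2 + c) = horner ('X^2 + c%:P).
  by apply/funext => s; rewrite hornerD hornerXn hornerC.
apply: is_derive_eq.
by rewrite derivD derivXn derivC addr0 hornerMn hornerXn mxE eqxx expr1 mulr_natl.
Qed.

Section slice.
Variables (phi W : R -> R).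
Hypotheses (cphi : continuous phi) (W1 : W 1 = 0).
(** On the ball, |x|^2 ranges over [0, 1]; the larger open interval makes the derivatives two-sided
    at both ends. *)
Hypothesis dW : forall s : R, -1 < s < 2 -> is_derive s (1 : R) W (phi s).

(* For harmonic [p], [q] of degrees [j], [l], the vector field
   [W(|x|^2) (p grad q - q grad p)] has divergence
   [2 (l - j) W'(|x|^2) p q] by Euler's identity, and it vanishes on the unit
   sphere as [W 1 = 0]. *)
Definition antisym_flux p q i x : R :=
  W (sqnorm x) * (pfun p x * pfun (mpoly.mderiv i q) x -
                  pfun q x * pfun (mpoly.mderiv i p) x).

(** The i-th partial derivative of [antisym_flux]; the products of two first derivatives cancel by
    antisymmetry. *)
Definition d_antisym_flux p q i x : R :=
  phi (sqnorm x) * (2 * x ord0 i) *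
    (pfun p x * pfun (mpoly.mderiv i q) x - pfun q x * pfun (mpoly.mderiv i p) x)
  + W (sqnorm x) * (pfun p x * pfun (mpoly.mderiv i (mpoly.mderiv i q)) x -
                    pfun q x * pfun (mpoly.mderiv i (mpoly.mderiv i p)) x).

Lemma sqnorm_itv x : eball x -> -1 < sqnorm x < 2.
Proof. by move/eballE; have := sqnorm_ge0 x; lra. Qed.

Lemma is_derive_antisym_flux p q i x t : eball (updrV x i t) ->
  is_derive t 1 (fun t => antisym_flux p q i (updrV x i t))
    (d_antisym_flux p q i (updrV x i t)).
Proof.
move=> xt.
have dWs : is_derive t (1 : R) (W \o (fun t => sqnorm (updrV x i t)))
   (phi (sqnorm (updrV x i t)) * (2 * updrV x i t ord0 i)).
  apply: is_derive1_comp; last exact: is_derive_sqnorm.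
  by apply: dW; exact: sqnorm_itv.
have dP r := is_derive_pfun r x i t.
have dPQ := is_deriveB (is_deriveM (dP p) (dP (mpoly.mderiv i q)))
                       (is_deriveM (dP q) (dP (mpoly.mderiv i p))).
apply: (is_derive_eq (is_deriveM dWs dPQ)).
rewrite /d_antisym_flux /= /GRing.scale /=.
rewrite !fctE.
ring.
Qed.

Lemma continuous_d_antisym_flux p q i : {within @eball R d, continuous (d_antisym_flux p q i)}.
Proof.
apply: continuous_in_subspaceT => x /set_mem xB.
have cp r : {for x, continuous (pfun r)} by exact: continuous_pfun.
have cx : {for x, continuous (fun x : 'rV[R]_d => x ord0 i)} by exact: coord_continuous.
have cs : {for x, continuous sqnorm} by exact: continuous_sqnorm.
have cphis : {for x, continuous (phi \o sqnorm)}.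
  by apply: continuous_comp => //; exact: cphi.
have cWs : {for x, continuous (W \o sqnorm)}.
  apply: continuous_comp => //; apply/differentiable_continuous/derivable1_diffP.
  by have [] := dW (sqnorm_itv xB).
have cPQ r1 r2 : {for x, continuous
    (fun x => pfun p x * pfun r1 x - pfun q x * pfun r2 x)}.
  exact: (cvgB (cvgM (cp p) (cp r1)) (cvgM (cp q) (cp r2))).
exact: (cvgD (cvgM (cvgM cphis (cvgMl_tmp cx)) (cPQ _ _)) (cvgM cWs (cPQ _ _))).
Qed.

(** The line meets the ball in a segment whose endpoints have |x|^2 = 1. The flux vanishes there as
    W 1 = 0, so the fundamental theorem of calculus gives 0. *)
Lemma integral_slice_d_antisym_flux p q i x :
  (\int[@lebesgue_measure R]_t
     ((d_antisym_flux p q i \_ (@eball R d)) (updrV x i t))%:E = 0)%E.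
Proof.
pose c := \sum_(k < d | k != i) x ord0 k ^+ 2.
pose f t := d_antisym_flux p q i (updrV x i t).
have [c1|c1] := leP c 1; last first.
  apply: integral0_eq => t _; rewrite patchE memNset// => /eballE.
  by rewrite sqnorm_updrV -/c; have := sqr_ge0 t; lra.
pose a := Num.sqrt (1 - c).
have sliceE t : eball (updrV x i t) <-> t \in `[- a, a] by exact: eball_slice.
transitivity (\int[@lebesgue_measure R]_(t in `[(- a)%R, a]) (f t)%:E)%E.
  rewrite [RHS]integral_mkcond; apply: eq_integral => t _.
  rewrite !patchE; case: ifPn => [/set_mem/sliceE ta|/negP nt].
    by rewrite mem_set.
  by rewrite memNset// => /sliceE /mem_set.
(* A line touching the ball in one point contributes a null set; the fundamental theorem is applied
   only to a proper segment. *)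
have [a0|a0] := eqVneq a 0.
  by rewrite a0 oppr0 set_itv1 integral_set1.
have {}a0 : 0 < a by rewrite lt_neqAle eq_sym a0 sqrtr_ge0.
pose F t := antisym_flux p q i (updrV x i t).
have F0 t : t ^+ 2 = a ^+ 2 -> F t = 0.
  move=> ta; rewrite /F /antisym_flux sqnorm_updrV ta -/c sqr_sqrtr ?subr_ge0//.
  by rewrite subrK W1 mul0r.
have dF t : t \in `[- a, a] -> is_derive t 1 F (f t).
  by move=> /sliceE; exact: is_derive_antisym_flux.
have cF t : t \in `[- a, a] -> {for t, continuous F}.
  move=> /dF h; apply/differentiable_continuous/derivable1_diffP.
  by have [] := h.
rewrite (@continuous_FTC2 _ _ F) ?F0 ?sqrrN ?sube0//.
- lra.
- apply/subspace_continuousP => t /= /sliceE tB.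
  apply: (@cvg_comp _ _ _ (updrV x i) (d_antisym_flux p q i) _
    (within (@eball R d) (nbhs (updrV x i t)))); last first.
    by have /subspace_continuousP/(_ _ tB) := @continuous_d_antisym_flux p q i.
  move=> U /= UB; have := @continuous_updrV x i t _ UB.
  by apply: (@filterS _ (nbhs t)) => s h sa; apply: h; exact/sliceE.
- split.
  + by move=> t /subset_itv_oo_cc /dF[].
  + by apply: cvg_at_right_filter; apply: cF; rewrite in_itv/=; lra.
  + by apply: cvg_at_left_filter; apply: cF; rewrite in_itv/=; lra.
- move=> t /subset_itv_oo_cc /dF h; rewrite derive1E.
  by have [] := h.
Qed.

Lemma bounded_eball (f : 'rV[R]_d -> R) : {within @eball R d, continuous f} ->
  exists M, forall x, `|(f \_ (@eball R d)) x| <= M.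
Proof.
move=> cf; have [M [_ hM]] := compact_bounded (continuous_compact cf compact_eball).
exists (`|M| + 1) => x; rewrite patchE; case: ifPn => [/set_mem xB|_].
  by apply: hM; [rewrite ltr_pwDr// ler_norm|exists x].
by rewrite normr0 addr_ge0.
Qed.

Lemma measurable_patch_eball (f : 'rV[R]_d -> R) :
  {within @eball R d, continuous f} ->
  measurable_fun setT (f \_ (@eball R d) : _ -> measurableTypeR R).
Proof.
move=> cf; apply: (measurable_restrictT _ (@measurable_eball R d)).1.
by apply: continuous_measurable_rV => //; exact: measurable_eball.
Qed.

Lemma lebesgue_eball_fin : (lebesgue_rV R d (@eball R d) < +oo)%E.
Proof.
apply: (@le_lt_trans _ _ (lebesgue_rV R d (ball 0 2))); last first.
  by rewrite lebesgue_rV_ball// ltry.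
apply: le_measure; rewrite ?inE//; last exact: eball_sub_ball.
- exact: measurable_eball.
- exact: measurable_rV_ball.
Qed.

Lemma integrable_eball (f : 'rV[R]_d -> R) : {within @eball R d, continuous f} ->
  (lebesgue_rV R d).-integrable setT (EFin \o (f \_ (@eball R d))).
Proof.
move=> cf; have [M fM] := bounded_eball cf.
apply: (bounded_support_integrable (A := @eball R d) (M := M)) => //.
- exact: measurable_eball.
- exact: lebesgue_eball_fin.
- exact: measurable_patch_eball.
- by move=> x xB; rewrite patchE memNset.
Qed.

(** Each partial derivative integrates to 0 separately, slice by slice, so the divergence theorem is
    obtained without a surface integral. *)
Lemma integral_d_antisym_flux p q i :
  (\int[lebesgue_rV R d]_x ((d_antisym_flux p q i \_ (@eball R d)) x)%:E = 0)%E.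
Proof.
have [M fM] := bounded_eball (@continuous_d_antisym_flux p q i).
apply: (integral_lebesgue_rV_slice0 (i := i) (M := M) (r := 2)) => //.
- by apply: measurable_patch_eball; exact: continuous_d_antisym_flux.
- by move=> x nx; rewrite patchE memNset// => /eball_sub_ball.
- exact: integral_slice_d_antisym_flux.
Qed.

Lemma sum_d_antisym_flux j l p q x :
  p \is mpoly.ishomog1 j mpoly.mdeg -> q \is mpoly.ishomog1 l mpoly.mdeg ->
  \sum_(i < d) mpoly.mderiv i (mpoly.mderiv i p) = 0 ->
  \sum_(i < d) mpoly.mderiv i (mpoly.mderiv i q) = 0 ->
  \sum_(i < d) d_antisym_flux p q i x =
  2 * (l%:R - j%:R) * (phi (sqnorm x) * (pfun p x * pfun q x)).
Proof.
move=> hp hq lp lq; have ep := pfun_euler x hp; have eq := pfun_euler x hq.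
have {}lp : \sum_(i < d) pfun (mpoly.mderiv i (mpoly.mderiv i p)) x = 0.
  by rewrite -[RHS](mpoly.meval0 (fun i => x ord0 i)) -lp [RHS]raddf_sum.
have {}lq : \sum_(i < d) pfun (mpoly.mderiv i (mpoly.mderiv i q)) x = 0.
  by rewrite -[RHS](mpoly.meval0 (fun i => x ord0 i)) -lq [RHS]raddf_sum.
transitivity (2 * phi (sqnorm x) *
    (pfun p x * \sum_(i < d) x ord0 i * pfun (mpoly.mderiv i q) x -
     pfun q x * \sum_(i < d) x ord0 i * pfun (mpoly.mderiv i p) x) +
  W (sqnorm x) *
    (pfun p x * \sum_(i < d) pfun (mpoly.mderiv i (mpoly.mderiv i q)) x -
     pfun q x * \sum_(i < d) pfun (mpoly.mderiv i (mpoly.mderiv i p)) x)).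
  rewrite !mulr_sumr -!sumrB !mulr_sumr -big_split/=.
  by apply: eq_bigr => i _; rewrite /d_antisym_flux; ring.
by rewrite ep eq lp lq; ring.
Qed.

(** The divergence integrates to 0 termwise, and it is also 2 (l - j) times the integrand; this
    factor can be divided out as j != l. *)
Lemma integral_eball_harmonic j l p q : j != l ->
  p \is mpoly.ishomog1 j mpoly.mdeg -> q \is mpoly.ishomog1 l mpoly.mdeg ->
  \sum_(i < d) mpoly.mderiv i (mpoly.mderiv i p) = 0 ->
  \sum_(i < d) mpoly.mderiv i (mpoly.mderiv i q) = 0 ->
  (\int[lebesgue_rV R d]_(x in @eball R d)
    (phi (sqnorm x) * (pfun p x * pfun q x))%:E = 0)%E.
Proof.
move=> jl hp hq lp lq.
have : (\int[lebesgue_rV R d]_x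
    (\sum_(i < d) ((d_antisym_flux p q i \_ (@eball R d)) x)%:E) = 0)%E.
  rewrite integral_sum//; last first.
    by move=> i; apply: integrable_eball; exact: continuous_d_antisym_flux.
  by rewrite big1// => i _; exact: integral_d_antisym_flux.
pose c : R := 2 * (l%:R - j%:R).
have c0 : c != 0 by rewrite mulf_neq0// subr_eq0 eqr_nat eq_sym.
rewrite (_ : (fun x => _) = (fun x => c%:E *
  (((fun x => phi (sqnorm x) * (pfun p x * pfun q x)) \_ (@eball R d)) x)%:E)%E); last first.
  apply/funext => x; rewrite -EFinM sumEFin; congr EFin.
  rewrite patchE; case: ifPn => xB.
    under eq_bigr do rewrite patchE xB.
    by rewrite (@sum_d_antisym_flux j l).
  under eq_bigr do rewrite patchE (negbTE xB).
  by rewrite big1 ?mulr0.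
have cf : {within @eball R d, continuous (fun x => phi (sqnorm x) * (pfun p x * pfun q x))}.
  apply: continuous_subspaceT; apply: continuous_mulf.
    by move=> x; apply: (continuous_comp (@continuous_sqnorm x)); exact: cphi.
  by apply: continuous_mulf; exact: continuous_pfun.
rewrite integralZl//; last exact: integrable_eball.
move/eqP; rewrite mule_eq0 eqe (negbTE c0)/= => /eqP h.
rewrite integral_mkcond -[RHS]h; apply: eq_integral => x _.
by rewrite !patchE; case: ifP.
Qed.

End slice.

End BallOrthogonality.

(** * The surface measure *)

(** The primitive is based at -1, to the left of [0, 1], and then shifted by its value at 1. *)
Lemma exists_primitive (R : realType) (phi : R -> R) : continuous phi ->
  exists2 W : R -> R, W 1 = 0 &
    forall s : R, -1 < s < 2 -> is_derive s (1 : R) W (phi s).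
Proof.
move=> cphi; pose mu := @lebesgue_measure R.
pose F x := \int[mu]_(t in `[-1, x]) phi t.
exists (fun x => F x - F 1); first by rewrite subrr.
move=> s /andP[s1 s2].
have iphi : mu.-integrable `[-1, 2] (EFin \o phi).
  apply: continuous_compact_integrable; first exact: segment_compact.
  by apply: continuous_subspaceT => x; exact: cphi.
have [dF F's] := @continuous_FTC1_closed R phi (-1) s 2 s2 iphi s1 (cphi s).
have h : is_derive s (1 : R) F (phi s).
  by apply: (DeriveDef dF); rewrite -derive1E.
apply: (is_derive_eq (is_deriveB h (is_derive_cst (F 1) s 1))).
by rewrite subr0.
Qed.

Section mscale_mrestr.
Local Open Scope ereal_scope.
Context d (T : measurableType d) (R : realType) (mu : {measure set T -> \bar R}).

Lemma integral_mscale (k : {nonneg R}) (D : set T) (f : T -> \bar R) :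
  measurable D -> mu.-integrable D f ->
  \int[mscale k mu]_(x in D) f x = k%:num%:E * \int[mu]_(x in D) f x.
Proof.
move=> mD intf; have mf := measurable_int _ intf.
transitivity (k%:num%:E * (\int[mu]_(x in D) f^\+ x - \int[mu]_(x in D) f^\- x)).
  rewrite muleBr//; last first.
    apply: fin_num_adde_defl; rewrite fin_numN.
    by apply: integrable_fin_num => //; exact: integrable_funeneg.
  rewrite (integralE (mscale k mu) D f).
  by congr (_ - _); apply: ge0_integral_mscale => //;
    [exact: measurable_funepos|exact: measurable_funeneg].
by rewrite -integralE.
Qed.

Lemma integral_mrestr (D B : set T) (mB : measurable B) (f : T -> \bar R) :
  measurable D -> (mrestr mu mB).-integrable D f ->
  \int[mrestr mu mB]_(x in D) f x = \int[mu]_(x in D `&` B) f x.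
Proof.
move=> mD intf.
rewrite (@negligible_integral _ _ _ (mrestr mu mB) D (~` B))//; last 2 first.
- exact: measurableC.
- by rewrite /= /mrestr setICl measure0.
rewrite setDE setCK; apply: eq_measure_integral => A mA AB.
by rewrite /= /mrestr; congr (mu _); apply: setIidl => x /AB[].
Qed.

End mscale_mrestr.

Section Sphere.
Context (R : realType) (d : nat).
Implicit Types (x : 'rV[R]_d) (f : 'rV[R]_d -> R).

Lemma enorm_ge0 x : 0 <= enorm x. Proof. exact: sqrtr_ge0. Qed.

Lemma sqr_enorm x : enorm x ^+ 2 = sqnorm x.
Proof. by rewrite sqr_sqrtr// sqnorm_ge0. Qed.

Lemma sphereE x : sphere x <-> sqnorm x = 1.
Proof.
rewrite -sqr_enorm; split=> [->|/eqP]; first by rewrite expr1n.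
by rewrite sqrf_eq1 => /orP[/eqP //|/eqP e]; have := enorm_ge0 x; rewrite e; lra.
Qed.

Lemma sphere_sub_eball : @sphere R d `<=` @eball R d.
Proof. by move=> x /sphereE xS; apply/eballE; rewrite xS. Qed.

Lemma continuous_enorm : continuous (@enorm R d).
Proof.
move=> x; apply: (continuous_comp (@continuous_sqnorm R d x)).
exact: sqrt_continuous.
Qed.

Lemma closed_sphere : closed (@sphere R d).
Proof.
have -> : @sphere R d = (@enorm R d) @^-1` [set 1] by [].
by apply: closed_comp; [move=> x _; exact: continuous_enorm|exact: closed_eq].
Qed.

Lemma compact_sphere : compact (@sphere R d).
Proof.
exact: (subclosed_compact closed_sphere (@compact_eball R d) sphere_sub_eball).
Qed.

Lemma measurable_sphere : measurable (@sphere R d).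
Proof.
by rewrite -[@sphere R d]setCK; apply: measurableC; apply: open_measurable_rV;
  apply: closed_openC; exact: closed_sphere.
Qed.

Lemma enormZ (a : R) x : enorm (a *: x) = `|a| * enorm x.
Proof.
rewrite /enorm; under eq_bigr do rewrite mxE exprMn.
by rewrite -mulr_sumr sqrtrM ?sqr_ge0// sqrtr_sqr.
Qed.

Lemma sphere_normalize x : sphere (normalize x) <-> enorm x != 0.
Proof.
rewrite /sphere /= enormZ normfV ger0_norm ?enorm_ge0//; split.
  by apply: contra_eq_neq => ->; rewrite invr0 mul0r eq_sym oner_neq0.
by move=> x0; rewrite mulVf.
Qed.

(** The cone over the sphere inside the ball: [normalize] fixes the origin, which is not on the
    sphere. *)
Definition punctured_eball : set 'rV[R]_d := [set x | enorm x != 0] `&` @eball R d.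

Lemma preimage_normalize_sphere :
  @normalize R d @^-1` @sphere R d = [set x | enorm x != 0].
Proof. by apply/seteqP; split => x /sphere_normalize. Qed.

Lemma measurable_enorm_neq0 : measurable [set x : 'rV[R]_d | enorm x != 0].
Proof.
rewrite -preimage_normalize_sphere -[X in measurable X]setTI.
by apply: (@measurable_normalize R d) => //; exact: measurable_sphere.
Qed.

Lemma measurable_punctured_eball : measurable punctured_eball.
Proof.
by apply: measurableI; [exact: measurable_enorm_neq0|exact: measurable_eball].
Qed.

Lemma surface_measureE A : measurable A ->
  surface_measure (R := R) A =
  (d%:R%:E * lebesgue_rV R d ((@normalize R d @^-1` A) `&` @eball R d))%E.
Proof. by []. Qed.

Lemma surface_measure_fin : (surface_measure (@sphere R d) < +oo)%E.
Proof.
rewrite surface_measureE; last exact: measurable_sphere.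
rewrite lte_mul_pinfty//; apply: le_lt_trans (@lebesgue_eball_fin R d).
rewrite preimage_normalize_sphere; apply: le_measure; rewrite ?inE.
- exact: measurable_punctured_eball.
- exact: measurable_eball.
- exact: subIsetr.
Qed.

Lemma bounded_sphere f : {within @sphere R d, continuous f} ->
  exists2 M, 0 < M & forall x, sphere x -> `|f x| <= M.
Proof.
move=> cf; have [M [_ hM]] := compact_bounded (continuous_compact cf compact_sphere).
exists (`|M| + 1) => [|x xS]; first by rewrite ltr_pwDr.
by apply: hM; [rewrite ltr_pwDr// ler_norm|exists x].
Qed.

Lemma measurable_sphere_fun f : {within @sphere R d, continuous f} ->
  measurable_fun (@sphere R d) (f : _ -> measurableTypeR R).
Proof. by apply: continuous_measurable_rV; exact: measurable_sphere. Qed.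

Lemma integrable_sphere f : {within @sphere R d, continuous f} ->
  (@surface_measure R d).-integrable (@sphere R d) (EFin \o f).
Proof.
move=> cf; have [M M0 fM] := bounded_sphere cf.
apply: measurable_bounded_integrable.
- exact: measurable_sphere.
- exact: surface_measure_fin.
- exact: measurable_sphere_fun.
- by exists M; split; [exact: num_real|move=> y My x xS; exact: le_trans (fM _ xS) (ltW My)].
Qed.

(** The cone formula for integrals: change of variables along the pushforward by [normalize] that
    defines the surface measure. *)
Lemma integral_surface_measure f : continuous f ->
  (\int[@surface_measure R d]_(x in @sphere R d) (f x)%:E =
   d%:R%:E * \int[lebesgue_rV R d]_(x in punctured_eball) (f (normalize x))%:E)%E.
Proof.
move=> cf.
have mf : measurable_fun setT (f : _ -> measurableTypeR R).
  by apply: continuous_measurable_rV => //; apply: continuous_subspaceT.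
have [M M0 fM] := bounded_sphere (continuous_subspaceT cf).
have bd : [bounded f (normalize x) | x in @normalize R d @^-1` @sphere R d].
  by exists M; split; [exact: num_real|move=> y My x xS; exact: le_trans (fM _ xS) (ltW My)].
have mfn : measurable_fun setT (f \o @normalize R d : _ -> measurableTypeR R).
  exact: (measurableT_comp mf (@measurable_normalize R d)).
have mS : measurable (@normalize R d @^-1` @sphere R d).
  by rewrite preimage_normalize_sphere; exact: measurable_enorm_neq0.
have fin : (mrestr (lebesgue_rV R d) (@measurable_eball R d)
    (@normalize R d @^-1` @sphere R d) < +oo)%E.
  rewrite /mrestr; apply: le_lt_trans (@lebesgue_eball_fin R d).
  apply: le_measure; rewrite ?inE//.
    apply: measurableI => //; exact: measurable_eball.
  exact: measurable_eball.
have int : (mrestr (lebesgue_rV R d) (@measurable_eball R d)).-integrable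
    (@normalize R d @^-1` @sphere R d) (EFin \o (f \o @normalize R d)).
  by apply: measurable_bounded_integrable => //; exact: measurable_funTS.
rewrite /surface_measure (integral_pushforward (@measurable_normalize R d)).
- rewrite integral_mscale//= integral_mrestr//.
  by rewrite preimage_normalize_sphere.
- exact/measurable_EFinP.
- apply: measurable_bounded_integrable => //; last exact: measurable_funTS.
  by rewrite /mscale lte_mul_pinfty.
- exact: measurable_sphere.
Qed.

End Sphere.

(** * Orthogonality of harmonics of different degrees *)

Section RealOrthogonality.
Context (R : realType) (d : nat).
Implicit Types (p q : mpoly.mpoly d R) (x : 'rV[R]_d).

(* [phi N n (|x|^2)] tends to [|x|^-N], the weight that turns a form of degree
   [N] on the ball into its degree 0 extension from the sphere; the term
   [n.+1%:R^-1] removes the singularity at 0. *)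
Let phi N (n : nat) (s : R) : R := (Num.sqrt s + n.+1%:R^-1)^-1 ^+ N.

Let sqrtD_gt0 n (s : R) : 0 < Num.sqrt s + n.+1%:R^-1.
Proof. by rewrite ltr_wpDl ?sqrtr_ge0// invr_gt0. Qed.

(** [Num.sqrt] is 0 on negative numbers, so the weight is continuous on the whole line, as
    [exists_primitive] requires. *)
Let continuous_phi N n : continuous (phi N n).
Proof.
apply: continuous_expf => s; apply: cvgV; first by rewrite gt_eqF.
by apply: cvgD; [exact: sqrt_continuous|exact: cvg_cst].
Qed.

(** With f = p q of degree N = j + l, the integrals over the ball of f against the weights
    [phi N n (|x|^2)] vanish. They converge by domination to the integral of |x|^-N f(x) = f(x/|x|),
    which the cone formula turns into the integral over the sphere. *)
Lemma integral_sphere_harmonic (j l : nat) p q : j != l ->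
  p \is mpoly.ishomog1 j mpoly.mdeg -> q \is mpoly.ishomog1 l mpoly.mdeg ->
  \sum_(i < d) mpoly.mderiv i (mpoly.mderiv i p) = 0 ->
  \sum_(i < d) mpoly.mderiv i (mpoly.mderiv i q) = 0 ->
  (\int[@surface_measure R d]_(x in @sphere R d) (pfun p x * pfun q x)%:E = 0)%E.
Proof.
move=> jl hp hq lp lq; pose f x := pfun p x * pfun q x.
have cf : continuous f by apply: continuous_mulf; exact: continuous_pfun.
have fZ (a : R) x : f (a *: x) = a ^+ (j + l) * f x.
  by rewrite /f (pfun_scale _ _ hp) (pfun_scale _ _ hq) exprD; ring.
rewrite (integral_surface_measure cf).
suff -> : (\int[lebesgue_rV R d]_(x in @punctured_eball R d) (f (normalize x))%:E = 0)%E.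
  by rewrite mule0.
pose g n x := phi (j + l) n (sqnorm x) * f x.
have g0 n : (\int[lebesgue_rV R d]_(x in @punctured_eball R d) (g n x)%:E = 0)%E.
  have [W W1 dW] := exists_primitive (@continuous_phi (j + l) n).
  rewrite -[RHS](integral_eball_harmonic (@continuous_phi (j + l) n) W1 dW jl hp hq lp lq).
  rewrite integral_mkcond [RHS]integral_mkcond; apply: eq_integral => x _.
  rewrite !patchE; case: ifPn => [/set_mem[_ xB]|]; first by rewrite mem_set.
  case: ifPn => // /set_mem xB /negP xP.
  (* The ball and the punctured ball differ only by the origin, where f vanishes: its degree j + l
     is positive because j != l. *)
  suff fx0 : f x = 0 by rewrite -/(f x) fx0 mulr0.
  have x0 : enorm x = 0.
    by apply/eqP/negPn/negP => x0; apply: xP; rewrite in_setE; split.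
  have -> : x = 0 *: x.
    rewrite scale0r; apply/rowP => i; rewrite mxE; apply/eqP.
    rewrite -normr_eq0 -sqrf_eq0 eq_le sqr_ge0 andbT.
    by rewrite (le_trans (sqnorm_coord_le x i))// -sqr_enorm x0 expr0n.
  by rewrite fZ expr0n addn_eq0; case: (j) (l) jl => [|?] [|?]//; rewrite mul0r.
have mP := @measurable_punctured_eball R d.
have [M M0 fM] := bounded_sphere (continuous_subspaceT cf).
have mfun (h : 'rV[R]_d -> R) : continuous h ->
    measurable_fun (@punctured_eball R d) (h : _ -> measurableTypeR R).
  move=> ch; apply: measurable_funTS; apply: continuous_measurable_rV => //.
  exact: continuous_subspaceT.
have lim_g x : punctured_eball x -> (g n x)%:E @[n --> \oo] --> (f (normalize x))%:E.
  move=> [x0 _]; apply: cvg_EFin; first by apply: nearW.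
  rewrite /normalize fZ; apply: cvgMr_tmp.
  rewrite /phi /sqnorm -/(enorm x).
  have : (enorm x + n.+1%:R^-1)^-1 @[n --> \oo] --> (enorm x)^-1.
    apply: cvgV => //; rewrite -[X in _ --> X]addr0; apply: cvgD.
      exact: cvg_cst.
    exact: cvg_harmonic.
  by move=> h; elim: (j + l)%N => [|k IH]; [exact: cvg_cst|
    under eq_fun do rewrite exprS; rewrite exprS; exact: cvgM].
(* The weight is at most |x|^-N, so |g n x| <= |f(x/|x|)| <= M. *)
have dom_g x n : punctured_eball x -> (`|(g n x)%:E| <= (cst M%:E) x)%E.
  move=> [x0 _]; rewrite abse_EFin lee_fin /=.
  apply: le_trans (fM (normalize x) _); last exact/sphere_normalize.
  rewrite /g /normalize fZ !normrM ler_wpM2r// /phi !normrX; apply: lerXn2r; rewrite ?nnegrE//.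
  have e0 : 0 < enorm x by rewrite lt_neqAle eq_sym x0 enorm_ge0.
  have e1 : 0 < enorm x + n.+1%:R^-1 := sqrtD_gt0 n (sqnorm x).
  rewrite /sqnorm -/(enorm x) !gtr0_norm ?invr_gt0//.
  by rewrite lef_pV2 ?posrE// lerDl invr_ge0.
have [] := @dominated_convergence _ _ _ (lebesgue_rV R d) _ mP
  (fun n x => (g n x)%:E) (fun x => (f (normalize x))%:E) (cst M%:E).
- move=> n; apply/measurable_EFinP; apply: mfun; apply: continuous_mulf => //.
  by move=> x; apply: (continuous_comp (@continuous_sqnorm R d x)); exact: continuous_phi.
- apply/measurable_EFinP; apply: measurable_funTS.
  apply: (measurableT_comp _ (@measurable_normalize R d)).
  by apply: continuous_measurable_rV => //; exact: continuous_subspaceT.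
- exact: aeW.
- apply: (@measurable_bounded_integrable _ _ _ _ (cst M)) => //.
    apply: le_lt_trans (@lebesgue_eball_fin R d); apply: le_measure; rewrite ?inE//.
      exact: measurable_eball.
    exact: subIsetr.
  exact: bounded_cst.
- by apply: aeW => x n; exact: dom_g.
move=> _ _; under eq_fun do rewrite g0.
by move=> /cvg_lim <-//; rewrite lim_cst.
Qed.

End RealOrthogonality.

(** * Real and imaginary parts *)

Section ComplexParts.
Context (R : realType).
Local Notation C := R[i].
Local Notation Re := (@complex.Re R).
Local Notation Im := (@complex.Im R).
Implicit Types z w : C.

Lemma RecD z w : Re (z + w) = Re z + Re w. Proof. by case: z; case: w. Qed.
Lemma ImcD z w : Im (z + w) = Im z + Im w. Proof. by case: z; case: w. Qed.
Lemma RecM z w : Re (z * w) = Re z * Re w - Im z * Im w.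
Proof. by case: z; case: w. Qed.
Lemma ImcM z w : Im (z * w) = Re z * Im w + Im z * Re w.
Proof. by case: z => a b; case: w => c e /=. Qed.
Lemma Rec_conj z : Re (z^*)%C = Re z. Proof. by case: z. Qed.
Lemma Imc_conj z : Im (z^*)%C = - Im z. Proof. by case: z. Qed.

Lemma Rec_sum (I : Type) (r : seq I) (F : I -> C) :
  Re (\sum_(i <- r) F i) = \sum_(i <- r) Re (F i).
Proof. by apply: (big_morph Re RecD). Qed.

Lemma Imc_sum (I : Type) (r : seq I) (F : I -> C) :
  Im (\sum_(i <- r) F i) = \sum_(i <- r) Im (F i).
Proof. by apply: (big_morph Im ImcD). Qed.

Lemma complex_eqP z w : Re z = Re w -> Im z = Im w -> z = w.
Proof. by case: z; case: w => ? ? ? ? /= -> ->. Qed.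

Lemma normc_sqrE z : ComplexField.Normc.normc z ^+ 2 = Re z ^+ 2 + Im z ^+ 2.
Proof.
by case: z => a b; rewrite /= sqr_sqrtr// addr_ge0// sqr_ge0.
Qed.

Lemma Re_continuous : continuous (Re : C^o -> R).
Proof.
move=> z A /nbhs_ballP[e /= e0 eA].
apply/nbhs_ballP; exists (e%:C)%C => [|w zw] /=; first by rewrite ltcR.
apply: eA; rewrite /ball /=.
have -> : Re z - Re w = Re (z - w) by case: z {zw}; case: w.
by rewrite -ltcR; apply: le_lt_trans (normc_ge_Re _) zw.
Qed.

Lemma Im_continuous : continuous (Im : C^o -> R).
Proof.
move=> z A /nbhs_ballP[e /= e0 eA].
apply/nbhs_ballP; exists (e%:C)%C => [|w zw] /=; first by rewrite ltcR.
apply: eA; rewrite /ball /=.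
have -> : Im z - Im w = - Re ((z - w) * 'i%C).
  by rewrite ReiNIm opprK; case: z {zw}; case: w.
rewrite normrN -ltcR; apply: le_lt_trans (normc_ge_Re _) _.
have i1 : `|'i%C| = 1 :> C.
  by rewrite normc_def /= expr0n expr1n add0r sqrtr1.
by rewrite normrM i1 mulr1.
Qed.

Section continuous_complex.
Context (T : topologicalType).
Implicit Types f g : T -> C.

(** Continuity by components, the form in which componentwise integrals use it. *)
Definition ccontinuous f := continuous (Re \o f) /\ continuous (Im \o f).

Lemma ccontinuous_cst z : ccontinuous (fun=> z).
Proof. by split; exact: cst_continuous. Qed.

Lemma ccontinuousD f g : ccontinuous f -> ccontinuous g ->
  ccontinuous (fun x => f x + g x).
Proof.
move=> [fr fi] [gr gi]; split.
  rewrite (_ : Re \o _ = fun x => Re (f x) + Re (g x)); first exact: continuous_addf.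
  by apply/funext => x; exact: RecD.
rewrite (_ : Im \o _ = fun x => Im (f x) + Im (g x)); first exact: continuous_addf.
by apply/funext => x; exact: ImcD.
Qed.

Lemma ccontinuousM f g : ccontinuous f -> ccontinuous g ->
  ccontinuous (fun x => f x * g x).
Proof.
move=> [fr fi] [gr gi].
have cN (h k : T -> R) : continuous h -> continuous k ->
    continuous (fun x => h x - k x).
  by move=> ch ck x; exact: (cvgB (ch x) (ck x)).
split.
  rewrite (_ : Re \o _ = fun x => Re (f x) * Re (g x) - Im (f x) * Im (g x)).
    by apply: cN; exact: continuous_mulf.
  by apply/funext => x; exact: RecM.
rewrite (_ : Im \o _ = fun x => Re (f x) * Im (g x) + Im (f x) * Re (g x)).
  by apply: continuous_addf; exact: continuous_mulf.
by apply/funext => x; exact: ImcM.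
Qed.

Lemma ccontinuous_conj f : ccontinuous f -> ccontinuous (fun x => (f x)^*%C).
Proof.
move=> [fr fi]; split.
  by rewrite (_ : Re \o _ = Re \o f)//; apply/funext => x; exact: Rec_conj.
rewrite (_ : Im \o _ = fun x => - (Im \o f) x).
  by move=> x; exact: (cvgN (fi x)).
by apply/funext => x; exact: Imc_conj.
Qed.

Lemma ccontinuous_sum (I : Type) (r : seq I) (F : I -> T -> C) :
  (forall i, ccontinuous (F i)) -> ccontinuous (fun x => \sum_(i <- r) F i x).
Proof.
move=> cF; elim: r => [|i r IH].
  by under eq_fun do rewrite big_nil; exact: ccontinuous_cst.
by under eq_fun do rewrite big_cons; exact: ccontinuousD.
Qed.

Lemma continuous_normc_sqr f : ccontinuous f ->
  continuous (fun x => ComplexField.Normc.normc (f x) ^+ 2).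
Proof.
move=> [fr fi].
rewrite (_ : (fun x => _) = fun x => (Re \o f) x ^+ 2 + (Im \o f) x ^+ 2).
  by apply: continuous_addf; exact: continuous_expf.
by apply/funext => x; exact: normc_sqrE.
Qed.

Lemma continuous_ccontinuous (f : T -> C^o) : continuous f -> ccontinuous f.
Proof.
move=> cf; split=> x; apply: continuous_comp (cf x) _.
  exact: Re_continuous.
exact: Im_continuous.
Qed.

End continuous_complex.
End ComplexParts.

(** * Integration of complex functions on the sphere *)

Section SphereInt.
Context (R : realType) (d : nat).
Local Notation C := R[i].
Local Notation Re := (@complex.Re R).
Local Notation Im := (@complex.Im R).
Local Notation S := (@sphere R d).
Local Notation sigma := (@surface_measure R d).
Implicit Types f g : 'rV[R]_d -> C.

Definition sphere_int f : C :=
  Complex (\int[sigma]_(x in S) Re (f x)) (\int[sigma]_(x in S) Im (f x)).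

Definition sphere_ccontinuous f := ccontinuous (f : subspace S -> C).

Lemma integrable_Re f : sphere_ccontinuous f ->
  sigma.-integrable S (EFin \o (Re \o f)).
Proof. by case=> fr _; exact: integrable_sphere. Qed.

Lemma integrable_Im f : sphere_ccontinuous f ->
  sigma.-integrable S (EFin \o (Im \o f)).
Proof. by case=> _ fi; exact: integrable_sphere. Qed.

Lemma eq_sphere_int f g : (forall x, S x -> f x = g x) ->
  sphere_int f = sphere_int g.
Proof. by move=> fg; congr Complex; apply: eq_Rintegral => x /set_mem/fg ->. Qed.

Lemma sphere_intD f g : sphere_ccontinuous f -> sphere_ccontinuous g ->
  sphere_int (fun x => f x + g x) = sphere_int f + sphere_int g.
Proof.
move=> cf cg; have mS := @measurable_sphere R d; apply: complex_eqP => /=.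
  under eq_Rintegral do rewrite RecD.
  by rewrite RintegralD//; exact: integrable_Re.
under eq_Rintegral do rewrite ImcD.
by rewrite RintegralD//; exact: integrable_Im.
Qed.

Lemma sphere_intZ z f : sphere_ccontinuous f ->
  sphere_int (fun x => z * f x) = z * sphere_int f.
Proof.
move=> cf; have mS := @measurable_sphere R d.
have ir := integrable_Re cf; have ii := integrable_Im cf.
have iZ (a : R) (h : 'rV[R]_d -> R) : sigma.-integrable S (EFin \o h) ->
    sigma.-integrable S (EFin \o (fun x => a * h x)).
  move=> ih; rewrite (_ : EFin \o _ = (fun x => a%:E * (EFin \o h) x)%E).
    exact: integrableZl.
  by apply/funext => x; rewrite /= EFinM.
apply: complex_eqP.
  rewrite RecM /=; under eq_Rintegral do rewrite RecM.
  by rewrite RintegralB ?RintegralZl//; exact: iZ.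
rewrite ImcM /=; under eq_Rintegral do rewrite ImcM.
by rewrite RintegralD ?RintegralZl//; exact: iZ.
Qed.

Lemma sphere_int0 : sphere_int (fun=> 0) = 0.
Proof.
by rewrite /sphere_int /Rintegral !integral0_eq.
Qed.

Lemma sphere_int_sum (I : Type) (r : seq I) (F : I -> 'rV[R]_d -> C) :
  (forall i, sphere_ccontinuous (F i)) ->
  sphere_int (fun x => \sum_(i <- r) F i x) = \sum_(i <- r) sphere_int (F i).
Proof.
move=> cF; elim: r => [|i r IH].
  by under eq_sphere_int do rewrite big_nil; rewrite big_nil sphere_int0.
under eq_sphere_int do rewrite big_cons.
by rewrite big_cons sphere_intD ?IH//; exact: ccontinuous_sum.
Qed.

(* Unlike [ge0_le_integral], this requires no measurability. *)
Lemma le_integral_ge0 d' (T : measurableType d')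
    (mu : {measure set T -> \bar R}) (D : set T) (f g : T -> \bar R) :
  (forall x, D x -> 0 <= f x)%E -> (forall x, D x -> f x <= g x)%E ->
  (\int[mu]_(x in D) f x <= \int[mu]_(x in D) g x)%E.
Proof.
move=> f0 fg; rewrite !ge0_integralE//; last first.
  by move=> x Dx; exact: le_trans (f0 x Dx) (fg x Dx).
apply: le_ereal_sup => _ [h /= hf <-]; exists h => // x.
by apply: le_trans (hf x) _; exact: lee_restrict.
Qed.

(** The cone over U contains a neighbourhood of x/2, hence a small cube inside the ball and away
    from the origin, which has positive volume. *)
Lemma surface_measure_gt0 (U : set 'rV[R]_d) x : open U -> U x -> S x ->
  (0 < sigma (U `&` S))%E.
Proof.
move=> oU Ux Sx; have x1 : enorm x = 1 by exact: Sx.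
have d0 : (0 < d)%N.
  case: d x {oU Ux Sx} x1 => // y; rewrite /enorm big_ord0 sqrtr0 => /eqP.
  by rewrite eq_sym oner_eq0.
rewrite surface_measureE; last first.
  by apply: measurableI; [exact: open_measurable_rV|exact: measurable_sphere].
apply: mule_gt0; first by rewrite lte_fin ltr0n.
pose z := 2^-1 *: x.
have ez : enorm z = 2^-1 by rewrite enormZ x1 mulr1 gtr0_norm.
have nz : normalize z = x by rewrite /normalize ez scalerA mulVf// scale1r.
have cn : {for z, continuous (@normalize R d)}.
  have ci : {for z, continuous (fun y : 'rV[R]_d => (enorm y)^-1)}.
    have ez0 : enorm z != 0 by rewrite ez invr_eq0.
    exact: (cvgV ez0 (@continuous_enorm R d z)).
  exact: (cvgZ ci (@cvg_id _ (nbhs z))).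
have nU : nbhs z (@normalize R d @^-1` U).
  by apply: cn; apply: open_nbhs_nbhs; rewrite nz.
have n1 : nbhs z (@enorm R d @^-1` [set s | s < 1]).
  apply: (@continuous_enorm R d z); rewrite ez; apply: open_nbhs_nbhs; split.
    exact: open_lt.
  by rewrite /=; lra.
have n0 : nbhs z (@enorm R d @^-1` [set s | 0 < s]).
  apply: (@continuous_enorm R d z); rewrite ez; apply: open_nbhs_nbhs; split.
    exact: open_gt.
  by rewrite /=; lra.
have /nbhs_ballP[e /= e0 eB] : nbhs z (@normalize R d @^-1` U `&`
    @enorm R d @^-1` [set s | s < 1] `&` @enorm R d @^-1` [set s | 0 < s]).
  exact: filterI (filterI nU n1) n0.
apply: (@lt_le_trans _ _ (lebesgue_rV R d (ball z e))).
  by rewrite lebesgue_rV_ball// lte_fin exprn_gt0// pmulrn_lgt0.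
apply: le_measure; rewrite ?inE; first exact: measurable_rV_ball.
- apply: measurableI; last exact: measurable_eball.
  rewrite -[X in measurable X]setTI; apply: (@measurable_normalize R d) => //.
  by apply: measurableI; [exact: open_measurable_rV|exact: measurable_sphere].
- move=> y /eB[[/= yU y1] y0]; split; last exact: ltW.
  by split => //; apply/sphere_normalize; rewrite gt_eqF.
Qed.

(** By compactness of the sphere, h x converges to h x0 uniformly in y as x tends to x0, and the
    sphere has finite measure. *)
Lemma continuous_Rintegral_section (h : 'rV[R]_d -> 'rV[R]_d -> R) :
  {within S `*` S, continuous (fun p : 'rV[R]_d * 'rV[R]_d => h p.1 p.2)} ->
  (forall x, S x -> {within S, continuous (h x)}) ->
  {within S, continuous (fun x => \int[sigma]_(y in S) h x y)}.
Proof.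
move=> ch chx; apply/subspace_continuousP => x0 Sx0.
have mS := @measurable_sphere R d.
apply/cvgrPdist_le => e e0 /=.
have sfin : sigma S \is a fin_num by rewrite ge0_fin_numE// surface_measure_fin.
pose s := fine (sigma S).
have s0 : 0 <= s by rewrite fine_ge0.
(* Integrating e' over the sphere gives e s / (s + 1) <= e; the added 1 keeps the denominator
   positive even for s = 0. *)
pose e' := e / (s + 1).
have e'0 : 0 < e' by rewrite divr_gt0//; lra.
have /(compact_near_coveringP _).1 cov := @compact_sphere R d.
have {}cov : \forall x \near within S (nbhs x0),
    S `<=` (fun y => S y -> `|h x0 y - h x y| <= e').
  apply: cov => y Sy.
  have e'20 : 0 < e' / 2 by rewrite divr_gt0.
  have /subspace_continuousP/(_ (x0, y) (conj Sx0 Sy)) := ch.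
  move=> /cvgrPdist_lt/(_ _ e'20)[[U V] /= [Ux Vy] UV].
  exists (V, U `&` S) => /=.
    by split => //; apply: filterS Ux => x Ux Sx.
  move=> [y' x] [/= Vy' [Ux' Sx]] Sy'.
  have /= h1 := UV (x, y') (conj Ux' Vy') (conj Sx Sy').
  have /= h2 := UV (x0, y') (conj (nbhs_singleton Ux) Vy') (conj Sx0 Sy').
  apply: le_trans (ler_distD (h x0 y) _ _) _.
  by rewrite (distrC (h x0 y')) [leRHS]splitr; apply: lerD; exact: ltW.
have Snear : \forall x \near within S (nbhs x0), S x by exact: withinT.
apply: filterS2 cov Snear => x cov Sx.
have intx := integrable_sphere (chx x Sx).
have intx0 := integrable_sphere (chx x0 Sx0).
have intB : sigma.-integrable S (EFin \o (fun y => h x0 y - h x y)).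
  rewrite (_ : EFin \o _ = (EFin \o h x0) \- (EFin \o h x))%E.
    exact: integrableB.
  by apply/funext => y; rewrite /= EFinB.
rewrite -RintegralB//; apply: le_trans (le_normr_Rintegral mS intB) _.
apply: (@le_trans _ _ (\int[sigma]_(y in S) e')).
  apply: le_Rintegral => //.
  - exact: integrable_norm.
  - by apply: integrable_sphere; apply: continuous_subspaceT; exact: cst_continuous.
  - by move=> y Sy; exact: cov.
rewrite Rintegral_cst// -/s /e' mulrAC ler_pdivrMr; last lra.
by rewrite ler_wpM2l// ?ltW//; lra.
Qed.

End SphereInt.

(** * Complex harmonics and their orthogonality *)

Section ComplexHarmonics.
Context (R : realType) (d : nat).
Local Notation C := R[i].
Local Notation Re := (@complex.Re R).
Local Notation Im := (@complex.Im R).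
Local Notation S := (@sphere R d).
Implicit Types (p : mpoly.mpoly d C) (x : 'rV[R]_d).

Definition cpfun p x : C := mpoly.meval (fun i => (x ord0 i)%:C%C) p.

Section additive_part.
(** Stands for the real or the imaginary part, applied to the coefficients of a polynomial. *)
Variable h : {additive C -> R}.
Hypothesis hZ : forall z (a : R), h (z * (a%:C)%C) = h z * a.

Lemma additive_cpfun p x : h (cpfun p x) = pfun (mpoly.map_mpoly h p) x.
Proof.
rewrite /cpfun /pfun mpoly.mevalE raddf_sum /mpoly.map_mpoly /mpoly.mmap raddf_sum.
apply: eq_bigr => m _ /=; rewrite mpoly.mevalM mpoly.mevalC.
rewrite -hZ rmorph_prod; congr (h (_ * _)).
rewrite rmorph_prod /=; apply: eq_bigr => i _.
by rewrite !rmorphXn /= mpoly.mevalXU.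
Qed.

Lemma mderiv_map_mpoly p i :
  mpoly.mderiv i (mpoly.map_mpoly h p) = mpoly.map_mpoly h (mpoly.mderiv i p).
Proof.
apply/mpoly.mpolyP => m.
by rewrite mpoly.mcoeff_deriv !mpoly.mcoeff_map_mpoly /= mpoly.mcoeff_deriv raddfMn.
Qed.

Lemma homog_map_mpoly j p : p \is mpoly.ishomog1 j mpoly.mdeg ->
  mpoly.map_mpoly h p \is mpoly.ishomog1 j mpoly.mdeg.
Proof.
move=> /mpoly.dhomogP hp; apply/mpoly.dhomogP => m.
rewrite mpoly.mcoeff_msupp mpoly.mcoeff_map_mpoly /= => hm; apply: hp.
by rewrite mpoly.mcoeff_msupp; apply: contra_neq hm => ->; rewrite raddf0.
Qed.

Lemma laplacian_map_mpoly p : mlaplacian p = 0 ->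
  \sum_(i < d) mpoly.mderiv i (mpoly.mderiv i (mpoly.map_mpoly h p)) = 0.
Proof.
move=> lp; under eq_bigr do rewrite !mderiv_map_mpoly.
rewrite -[RHS](raddf0 (mpoly.map_mpoly h)) -lp raddf_sum.
by [].
Qed.
End additive_part.

Lemma Re_cpfun p x : Re (cpfun p x) = pfun (mpoly.map_mpoly Re p) x.
Proof. by apply: additive_cpfun => z a; rewrite /= RecM /= mulr0 subr0. Qed.

Lemma Im_cpfun p x : Im (cpfun p x) = pfun (mpoly.map_mpoly Im p) x.
Proof. by apply: additive_cpfun => z a; rewrite /= ImcM /= mulr0 add0r. Qed.

Lemma ccontinuous_cpfun p : sphere_ccontinuous (cpfun p).
Proof.
split; apply: continuous_subspaceT.
  by rewrite (_ : _ \o _ = pfun (mpoly.map_mpoly Re p));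
    [exact: continuous_pfun|apply/funext => x; exact: Re_cpfun].
by rewrite (_ : _ \o _ = pfun (mpoly.map_mpoly Im p));
  [exact: continuous_pfun|apply/funext => x; exact: Im_cpfun].
Qed.

Lemma eq_sphere_ccontinuous (f g : 'rV[R]_d -> C) :
  (forall x, S x -> f x = g x) -> sphere_ccontinuous f -> sphere_ccontinuous g.
Proof.
move=> fg [fr fi]; split.
  by apply: subspace_eq_continuous fr => x /set_mem Sx /=; rewrite fg.
by apply: subspace_eq_continuous fi => x /set_mem Sx /=; rewrite fg.
Qed.

Lemma ccontinuous_harmonic j (f : 'rV[R]_d -> C) : spherical_harmonic j f -> sphere_ccontinuous f.
Proof.
move=> [p [_ _ fp]]; apply: eq_sphere_ccontinuous (ccontinuous_cpfun p).
by move=> x /fp.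
Qed.

(** The real and imaginary parts of p and q are again homogeneous and harmonic, and both parts of f
    conj(g) are combinations of products of them, to which the real case applies. *)
Lemma sphere_dot_harmonic (j l : nat) (f g : 'rV[R]_d -> C) : j != l ->
  spherical_harmonic j f -> spherical_harmonic l g -> sphere_dot f g = 0.
Proof.
move=> jl [p [hp lp fp]] [q [hq lq gq]].
have mS := @measurable_sphere R d.
pose P (h : {additive C -> R}) := pfun (mpoly.map_mpoly h p).
pose Q (h : {additive C -> R}) := pfun (mpoly.map_mpoly h q).
have I0 h k : \int[@surface_measure R d]_(x in S) (P h x * Q k x) = 0.
  rewrite /Rintegral (integral_sphere_harmonic jl)//; first exact: homog_map_mpoly.
  - exact: homog_map_mpoly.
  - exact: laplacian_map_mpoly.
  - exact: laplacian_map_mpoly.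
have iPQ h k : (@surface_measure R d).-integrable S (EFin \o (fun x => P h x * Q k x)).
  apply: integrable_sphere; apply: continuous_subspaceT.
  by apply: continuous_mulf; exact: continuous_pfun.
have fE x : S x -> f x = cpfun p x by exact: fp.
have gE x : S x -> g x = cpfun q x by exact: gq.
rewrite /sphere_dot; apply: complex_eqP => /=.
  rewrite (@eq_Rintegral _ _ _ _ _ (fun x => P Re x * Q Re x + P Im x * Q Im x)).
    by rewrite RintegralD// !I0 addr0.
  move=> x /set_mem Sx; rewrite fE// gE// RecM Rec_conj Imc_conj.
  by rewrite !Re_cpfun !Im_cpfun mulrN opprK.
rewrite (@eq_Rintegral _ _ _ _ _ (fun x => P Im x * Q Re x - P Re x * Q Im x)).
  by rewrite RintegralB// !I0 subr0.
move=> x /set_mem Sx; rewrite fE// gE// ImcM Rec_conj Imc_conj.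
by rewrite !Re_cpfun !Im_cpfun mulrN addrC.
Qed.

End ComplexHarmonics.

(** * Coefficients of the kernel *)

Section KernelCoefficients.
Context (R : realType) (d : nat).
Local Notation C := R[i].
Local Notation Re := (@complex.Re R).
Local Notation Im := (@complex.Im R).
Local Notation S := (@sphere R d).
Local Notation sigma := (@surface_measure R d).

Lemma within_section (V : topologicalType) (h : 'rV[R]_d * 'rV[R]_d -> V) x :
  {within S `*` S, continuous h} -> S x -> {within S, continuous (fun y => h (x, y))}.
Proof.
move=> /subspace_continuousP ch Sx; apply/subspace_continuousP => y Sy A hA.
have [[U W] /= [Ux Wy] UW] := ch (x, y) (conj Sx Sy) A hA.
apply: filterS Wy => y' Wy' Sy'.
exact: (UW (x, y') (conj (nbhs_singleton Ux) Wy') (conj Sx Sy')).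
Qed.

Lemma within_snd (V : topologicalType) (h : 'rV[R]_d -> V) :
  {within S, continuous h} -> {within S `*` S, continuous (h \o snd)}.
Proof.
move=> /subspace_continuousP ch; apply/subspace_continuousP => -[x y] [/= Sx Sy] A hA.
have W := ch y Sy A hA.
exists (setT, fun y => S y -> A (h y)); first by split => //=; exact: filterT.
by move=> [x' y'] [/= _ h'] [/= _ /h'].
Qed.

(** Passes from convergence in the mean to vanishing at every point. If t x0 != 0, then |t| >= r on
    a neighbourhood of x0 in the sphere, which has positive measure; for small e the bound keeps F n
    above a positive constant there, so its integrals cannot tend to 0. *)
Lemma continuous_sphere_eq0 (t : 'rV[R]_d -> R) (F : nat -> 'rV[R]_d -> \bar R)
    (M B : R) :
  0 < M -> 0 <= B -> {within S, continuous t} ->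
  (forall n x, S x -> 0 <= F n x)%E ->
  (\int[sigma]_(x in S) F n x)%E @[n --> \oo] --> 0%E ->
  (forall e : R, 0 < e -> \forall n \near \oo, forall x, S x ->
     (`|t x|%:E <= (M / e)%:E * F n x + (e * B)%:E)%E) ->
  forall x, S x -> t x = 0.
Proof.
move=> M0 B0 /subspace_continuousP ct F0 cF tF x0 Sx0.
apply/eqP/negPn/negP => tx0.
pose r := `|t x0| / 2; have r0 : 0 < r by rewrite divr_gt0// normr_gt0.
have /cvgrPdist_lt/(_ r r0) := ct x0 Sx0.
rewrite withinE nbhsE => -[V [U [oU Ux0] UV] VS].
have Ut x : U x -> S x -> `|t x0 - t x| < r.
  move=> Ux Sx; have : (V `&` S) x by split => //; exact: UV.
  by rewrite -VS => -[].
have tU x : U x -> S x -> r <= `|t x|.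
  move=> Ux Sx; have /ltW := Ut x Ux Sx.
  have := ler_normD (t x0 - t x) (t x); rewrite subrK /r; lra.
(* Chosen so that e B <= r/2; the other half of r must then be covered by (M/e) F n x, which forces
   F n x >= k. *)
pose e := r / (2 * (B + 1)).
have e0 : 0 < e by rewrite divr_gt0//; lra.
have eB : e * B <= r / 2.
  rewrite /e invfM mulrA -mulrA -[leRHS]mulr1 ler_wpM2l//; first by rewrite ltW// divr_gt0.
  by rewrite mulrC ler_pdivrMr; lra.
pose k := r / 2 / (M / e); have k0 : 0 < k by apply: divr_gt0; apply: divr_gt0.
have mU : measurable (S `&` U).
  by apply: measurableI; [exact: measurable_sphere|exact: open_measurable_rV].
have kF : \forall n \near \oo, (k%:E * sigma (S `&` U) <= \int[sigma]_(x in S) F n x)%E.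
  have := tF e e0; apply: filterS => n tFn.
  rewrite -integral_cst// integral_mkcondr.
  apply: le_integral_ge0 => x Sx; rewrite patchE.
    by case: ifPn => // _; rewrite lee_fin ltW.
  case: ifPn => [/set_mem Ux|_]; last exact: F0.
  have : (r%:E <= (M / e)%:E * F n x + (e * B)%:E)%E.
    by apply: le_trans (tFn x Sx); rewrite lee_fin; exact: tU.
  case: (F n x) (F0 n x Sx) => [y||]//= y0; last by rewrite leey.
  rewrite -EFinM -EFinD !lee_fin => h.
  have Me0 : 0 < M / e by exact: divr_gt0.
  by rewrite /k ler_pdivrMr//; lra.
have : (k%:E * sigma (S `&` U) <= 0)%E.
  by rewrite -(cvg_lim _ cF)//; apply: lime_ge kF; exact: cvgP cF.
rewrite leNgt => /negP; apply; apply: mule_gt0; first by rewrite lte_fin.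
by rewrite setIC; exact: surface_measure_gt0 Sx0.
Qed.

(** From (|a| - e)^2 >= 0. It takes the place of the Cauchy-Schwarz inequality for integrals: small
    mean square gives small mean, up to e. *)
Lemma ler_sqr_amgm (a e : R) : 0 < e -> `|a| <= a ^+ 2 / e + e.
Proof.
move=> e0; rewrite -real_normK ?num_real//; have := normr_ge0 a; set b := `|a| => b0.
have := sqr_ge0 (b - e); rewrite sqrrB.
have -> : b ^+ 2 / e + e = (b ^+ 2 + e ^+ 2) / e by field; rewrite gt_eqF.
rewrite ler_pdivlMr//; nra.
Qed.

(** Both parts of E Y are at most M (|Re E| + |Im E|) in absolute value, and [ler_sqr_amgm] for each
    summand gives the pointwise bound (M/e) |E|^2 + 2 M e. *)
Lemma sphere_int_le (E Y : 'rV[R]_d -> C) (M e : R) :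
  0 < e -> sphere_ccontinuous E -> sphere_ccontinuous Y ->
  (forall y, S y -> `|Re (Y y)| <= M /\ `|Im (Y y)| <= M) ->
  let I := \int[sigma]_(y in S) (ComplexField.Normc.normc (E y) ^+ 2) in
  let b := M / e * I + 2 * M * e * fine (sigma S) in
  `|Re (sphere_int (fun y => E y * Y y))| <= b /\
  `|Im (sphere_int (fun y => E y * Y y))| <= b.
Proof.
move=> e0 cE cY YM I b; have mS := @measurable_sphere R d.
have cEY := ccontinuousM cE cY.
have cN := continuous_normc_sqr cE.
have iN := integrable_sphere cN.
have ib (u : 'rV[R]_d -> R) : {within S, continuous u} ->
    (forall y, S y -> `|u y| <= M * (`|Re (E y)| + `|Im (E y)|)) ->
    `|\int[sigma]_(y in S) u y| <= b.
  move=> cu uM; have iu := integrable_sphere cu.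
  apply: le_trans (le_normr_Rintegral mS iu) _.
  pose v y := M / e * ComplexField.Normc.normc (E y) ^+ 2 + 2 * M * e.
  have iN' : sigma.-integrable S
      (EFin \o (fun y => M / e * ComplexField.Normc.normc (E y) ^+ 2)).
    apply: integrable_sphere; apply: (@continuous_mulf _ (subspace S)) => //.
    exact: cst_continuous.
  have ic : sigma.-integrable S (EFin \o (fun=> 2 * M * e)).
    by apply: integrable_sphere; apply: continuous_subspaceT; exact: cst_continuous.
  apply: (@le_trans _ _ (\int[sigma]_(y in S) v y)); last first.
    by rewrite RintegralD// RintegralZl// Rintegral_cst.
  apply: le_Rintegral => //.
  - exact: integrable_norm.
  - apply: integrable_sphere; apply: (@continuous_addf _ (subspace S)).
      by apply: (@continuous_mulf _ (subspace S)) => //; exact: cst_continuous.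
    exact: cst_continuous.
  move=> y Sy; apply: le_trans (uM y Sy) _.
  have M0 : 0 <= M by have [+ _] := YM y Sy; apply: le_trans.
  have -> : v y = M * (Re (E y) ^+ 2 / e + e + (Im (E y) ^+ 2 / e + e)).
    by rewrite /v normc_sqrE; ring.
  by rewrite ler_wpM2l// lerD// ler_sqr_amgm.
case: cEY => cr ci; split; apply: ib => // y Sy; have [rM iM] := YM y Sy.
- rewrite /= RecM; apply: le_trans (ler_normB _ _) _; rewrite !normrM.
  by rewrite mulrDr !(mulrC M) lerD// ler_wpM2l.
- rewrite /= ImcM; apply: le_trans (ler_normD _ _) _; rewrite !normrM.
  by rewrite mulrDr !(mulrC M) lerD// ler_wpM2l.
Qed.

End KernelCoefficients.

(** * Recovering the coefficients from convergence in L^2 *)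

Section KernelExpansion.
Context (R : realType) (d : nat).
Local Notation C := R[i].
Local Notation Re := (@complex.Re R).
Local Notation Im := (@complex.Im R).
Local Notation S := (@sphere R d).
Local Notation sigma := (@surface_measure R d).

Variables (K : 'rV[R]_d -> 'rV[R]_d -> C)
  (Y : forall j, 'I_(harmonic_dim d j) -> 'rV[R]_d -> C)
  (D : forall j, 'M[C]_(harmonic_dim d j)).
Arguments Y : clear implicits.
Arguments D : clear implicits.
Hypothesis cK : continuous_kernel K.
Hypothesis onY : forall j, orthonormal_harmonic_basis (Y j).
Hypothesis KE : harmonic_expansion K Y D.
Local Notation P := (harmonic_partial_sum Y D).

Lemma ccontinuous_basis j k : sphere_ccontinuous (Y j k).
Proof. by have [hY _ _] := onY j; exact: ccontinuous_harmonic (hY k). Qed.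

Let ccontinuous_K :
  ccontinuous ((fun p => K p.1 p.2) : subspace (S `*` S) -> C).
Proof. exact: continuous_ccontinuous cK. Qed.

Lemma ccontinuous_kernel_section x : S x -> sphere_ccontinuous (K x).
Proof.
by move=> Sx; have [cr ci] := ccontinuous_K; split;
  [exact: (within_section cr Sx)|exact: (within_section ci Sx)].
Qed.

Let ccontinuous_P n x : sphere_ccontinuous (P n x).
Proof.
do 3 apply: ccontinuous_sum => ?.
apply: ccontinuousM; first exact: ccontinuous_cst.
by apply: ccontinuous_conj; exact: ccontinuous_basis.
Qed.

(** Other degrees drop out by [sphere_dot_harmonic], and within degree j orthonormality leaves only
    the index k'. The second factors of the series are conjugated, so integrating against Y_j^k'
    itself produces these inner products. *)
Lemma sphere_int_partial_sum j k' n x : (j < n)%N ->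
  sphere_int (fun y => P n x y * Y j k' y) = \sum_k D j k k' * Y j k x.
Proof.
move=> jn; transitivity (\sum_(l < n) \sum_k \sum_k''
    D l k k'' * Y l k x * sphere_dot (Y j k') (Y l k'')).
  have cM l k k'' : sphere_ccontinuous
      (fun y => D l k k'' * Y l k x * (Y j k' y * (Y l k'' y)^*%C)).
    apply: ccontinuousM; first exact: ccontinuous_cst.
    by apply: ccontinuousM; [|apply: ccontinuous_conj]; exact: ccontinuous_basis.
  transitivity (sphere_int (fun y => \sum_(l < n) \sum_k \sum_k''
      D l k k'' * Y l k x * (Y j k' y * (Y l k'' y)^*%C))).
    apply: eq_sphere_int => y _; rewrite mulr_suml; apply: eq_bigr => l _.
    rewrite mulr_suml; apply: eq_bigr => k _.
    by rewrite mulr_suml; apply: eq_bigr => k'' _; ring.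
  rewrite sphere_int_sum; last by move=> l; do 2 apply: ccontinuous_sum => ?; exact: cM.
  apply: eq_bigr => l _.
  rewrite sphere_int_sum; last by move=> k; apply: ccontinuous_sum => ?; exact: cM.
  apply: eq_bigr => k _; rewrite sphere_int_sum//; apply: eq_bigr => k'' _.
  rewrite sphere_intZ//.
  by apply: ccontinuousM; [|apply: ccontinuous_conj]; exact: ccontinuous_basis.
rewrite (bigD1 (Ordinal jn))//= [X in _ + X]big1 ?addr0; last first.
  move=> l lj; rewrite big1// => k _; rewrite big1// => k'' _.
  have [hj _ _] := onY j; have [hl _ _] := onY l.
  rewrite (sphere_dot_harmonic _ (hj k') (hl k'')) ?mulr0//.
  by apply: contra_neq lj => jl; apply: val_inj.
apply: eq_bigr => k _; have [_ onj _] := onY j.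
rewrite (bigD1 k')//= onj eqxx mulr1 big1 ?addr0// => k'' kk.
by rewrite onj eq_sym (negbTE kk) mulr0.
Qed.

(** The difference T of the two sides is continuous in x. For n > j it is the integral of (K - P n)
    Y_j^k', controlled by the squared L^2 error F n x of the section at x. These errors have
    integrals tending to 0, so [continuous_sphere_eq0] applies to both parts of T. *)
Lemma kernel_coefficient j k' x : S x ->
  sphere_int (fun y => K x y * Y j k' y) = \sum_k D j k k' * Y j k x.
Proof.
pose T x := sphere_int (fun y => K x y * Y j k' y)
            + (-1) * \sum_k D j k k' * Y j k x.
suff T0 : forall x, S x -> T x = 0.
  by move=> /T0/eqP; rewrite /T mulN1r subr_eq0 => /eqP.
pose E n x y := K x y + (-1) * P n x y.
have cE n x' : S x' -> sphere_ccontinuous (E n x').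
  move=> Sx'; apply: ccontinuousD; first exact: ccontinuous_kernel_section.
  by apply: ccontinuousM; [exact: ccontinuous_cst|exact: ccontinuous_P].
have TE n x' : (j < n)%N -> S x' -> T x' = sphere_int (fun y => E n x' y * Y j k' y).
  move=> jn Sx'; rewrite /T -(@sphere_int_partial_sum j k' n x' jn).
  have cPY : sphere_ccontinuous (fun y => P n x' y * Y j k' y).
    by apply: ccontinuousM; [exact: ccontinuous_P|exact: ccontinuous_basis].
  rewrite -sphere_intZ// -sphere_intD.
  - by apply: eq_sphere_int => y _; rewrite /E; ring.
  - by apply: ccontinuousM; [exact: ccontinuous_kernel_section|exact: ccontinuous_basis].
  - by apply: ccontinuousM => //; exact: ccontinuous_cst.
have cT : sphere_ccontinuous T.
  apply: ccontinuousD; last first.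
    apply: ccontinuousM; first exact: ccontinuous_cst.
    apply: ccontinuous_sum => k.
    by apply: ccontinuousM; [exact: ccontinuous_cst|exact: ccontinuous_basis].
  have [cYr cYi] := @ccontinuous_basis j k'.
  have [cr ci] : ccontinuous ((fun p => K p.1 p.2 * Y j k' p.2) : subspace (S `*` S) -> C).
    by apply: ccontinuousM => //; split; [exact: (within_snd cYr)|exact: (within_snd cYi)].
  split.
    apply: (@continuous_Rintegral_section _ _ (fun x y => Re (K x y * Y j k' y))) => //.
    by move=> x' Sx'; exact: (within_section cr Sx').
  apply: (@continuous_Rintegral_section _ _ (fun x y => Im (K x y * Y j k' y))) => //.
  by move=> x' Sx'; exact: (within_section ci Sx').
have [M M0 YM] : exists2 M, 0 < M & forall y, S y ->
    `|Re (Y j k' y)| <= M /\ `|Im (Y j k' y)| <= M.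
  have [/bounded_sphere[a a0 ha] /bounded_sphere[b b0 hb]] := @ccontinuous_basis j k'.
  exists (a + b); first exact: addr_gt0.
  by move=> y Sy; have := ha y Sy; have := hb y Sy; rewrite /=; split; lra.
pose F n x := (\int[sigma]_(y in S)
  (ComplexField.Normc.normc (K x y - P n x y) ^+ 2)%:E)%E.
have B0 : 0 <= 2 * M * fine (sigma S) by rewrite !mulr_ge0// ?fine_ge0// ltW.
have F0 n x' : S x' -> (0 <= F n x')%E.
  by move=> _; apply: integral_ge0 => y _; rewrite lee_fin sqr_ge0.
pose B e n x := ((M / e)%:E * F n x + (e * (2 * M * fine (sigma S)))%:E)%E.
have bnd e : 0 < e -> \forall n \near \oo, forall x', S x' ->
  ((`|Re (T x')|)%:E <= B e n x')%E /\ ((`|Im (T x')|)%:E <= B e n x')%E.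
  (* The partial sum P n contains the degrees below n, so degree j is present from n = j + 1 on. *)
  move=> e0; exists j.+1 => // n jn x' Sx'.
  have EE y : E n x' y = K x' y - P n x' y by rewrite /E mulN1r.
  have cN := continuous_normc_sqr (cE n x' Sx').
  have FE : F n x' =
      (\int[sigma]_(y in S) (ComplexField.Normc.normc (E n x' y) ^+ 2))%:E.
    rewrite /F; under eq_integral do rewrite -EE.
    rewrite fineK//; apply: integrable_fin_num; first exact: measurable_sphere.
    exact: (integrable_sphere cN).
  have [h1 h2] := sphere_int_le e0 (cE n x' Sx') (@ccontinuous_basis j k') YM.
  rewrite /B FE -EFinM -EFinD !lee_fin (TE n x' jn Sx').
  by rewrite (_ : e * (2 * M * _) = 2 * M * e * fine (sigma S)); last ring.
move=> x' Sx'; apply: complex_eqP.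
  apply: (continuous_sphere_eq0 M0 B0 cT.1 F0 KE) => // e /bnd.
  by apply: filterS => n h y /h[].
apply: (continuous_sphere_eq0 M0 B0 cT.2 F0 KE) => // e /bnd.
by apply: filterS => n h y /h[].
Qed.

End KernelExpansion.

(** * Powers of isotropic linear forms *)

Section IsotropicHarmonics.
Context (R : realType) (d : nat).
Local Notation C := R[i].
Implicit Types (u : 'I_d -> C) (x y z a b : 'rV[R]_d).

Definition linform u x : C := \sum_i u i * (x ord0 i)%:C%C.

Let mlinform u : mpoly.mpoly d C := \sum_i u i *: mpoly.mpolyX C (mpoly.mnm1 i).

Let mderiv_mlinform u i : mpoly.mderiv i (mlinform u) = u i *: 1.
Proof.
rewrite /mlinform raddf_sum (bigD1 i)//= mpoly.mderivZ mpoly.mderivX.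
rewrite mpoly.mnm1E eqxx scale1r big1 ?addr0 => [|k ki].
  have -> : mpoly.mnm_sub (mpoly.mnm1 i) (mpoly.mnm1 i) = mpoly.mnm0.
    by apply/mpoly.mnmP => k; rewrite mpoly.mnmBE subnn mpoly.mnm0E.
  by rewrite mpoly.mpolyX0.
by rewrite mpoly.mderivZ mpoly.mderivX mpoly.mnm1E (negbTE ki) scale0r scaler0.
Qed.

Let mderiv_mlinformX u i n :
  mpoly.mderiv i (mlinform u ^+ n) = (u i *+ n) *: mlinform u ^+ n.-1.
Proof.
elim: n => [|n IH]; first by rewrite expr0 mulr0n scale0r -mpoly.mpolyC1 mpoly.mderivC.
rewrite exprS mpoly.mderivM IH mderiv_mlinform -scalerAl mul1r /= -scalerAr.
case: n {IH} => [|n]; first by rewrite mulr0n scale0r addr0 mulr1n.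
by rewrite -exprS /= -scalerDl [in RHS]mulrS.
Qed.

(** The Laplacian of L^j is j (j - 1) (sum_i u_i^2) L^(j-2); for j < 2 the truncated exponent does
    no harm, as j (j - 1) = 0. *)
Lemma spherical_harmonic_isotropic u j : \sum_i u i ^+ 2 = 0 ->
  spherical_harmonic j (fun x => linform u x ^+ j).
Proof.
move=> u0; exists (mlinform u ^+ j); split.
- rewrite -[X in mpoly.ishomog1 X]mul1n; apply: mpoly.dhomogMn.
  rewrite rpred_sum// => i _; rewrite rpredZ//.
  by rewrite mpoly.dhomogX /= mpoly.mdeg1.
- rewrite /mlaplacian.
  transitivity ((\sum_i u i ^+ 2) *: ((mlinform u ^+ j.-2) *+ (j * j.-1))).
    rewrite scaler_suml; apply: eq_bigr => i _.
    rewrite mderiv_mlinformX mpoly.mderivZ mderiv_mlinformX scalerA.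
    by rewrite mulrnAl mulrnAr -mulrnA -expr2 [(j.-1 * _)%N]mulnC -scalerMnr scalerMnl.
  by rewrite u0 scale0r.
- move=> x _; rewrite rmorphXn; congr (_ ^+ _); rewrite /mlinform raddf_sum.
  by apply: eq_bigr => i _; rewrite /= mpoly.mevalZ mpoly.mevalXU.
Qed.

Definition rVdot x y : R := \sum_i x ord0 i * y ord0 i.

Lemma rVdotC x y : rVdot x y = rVdot y x.
Proof. by apply: eq_bigr => i _; rewrite mulrC. Qed.

Lemma rVdotDl x y z : rVdot (x + y) z = rVdot x z + rVdot y z.
Proof. by rewrite -big_split; apply: eq_bigr => i _; rewrite mxE mulrDl. Qed.

Lemma rVdotZl (k : R) x y : rVdot (k *: x) y = k * rVdot x y.
Proof. by rewrite mulr_sumr; apply: eq_bigr => i _; rewrite mxE mulrA. Qed.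

Lemma rVdotDr x y z : rVdot z (x + y) = rVdot z x + rVdot z y.
Proof. by rewrite rVdotC rVdotDl !(rVdotC _ z). Qed.

Lemma rVdotZr (k : R) x y : rVdot y (k *: x) = k * rVdot y x.
Proof. by rewrite rVdotC rVdotZl rVdotC. Qed.

Lemma rVdotx0 x : rVdot x 0 = 0.
Proof. by rewrite -(scale0r 0) rVdotZr mul0r. Qed.

Lemma rVdotxx x : rVdot x x = sqnorm x.
Proof. by apply: eq_bigr => i _; rewrite expr2. Qed.

Lemma sqnorm_eq0 x : sqnorm x = 0 -> x = 0.
Proof.
move=> x0; apply/rowP => i; rewrite mxE; apply/eqP; rewrite -normr_eq0 -sqrf_eq0.
by rewrite eq_le sqr_ge0 -x0 sqnorm_coord_le.
Qed.

(** Two linear equations in d > 2 unknowns have a nonzero solution. *)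
Lemma exists_orthogonal_functional x y : (2 < d)%N ->
  exists w : 'rV[R]_d, [/\ w != 0, rVdot w x = 0 & rVdot w y = 0].
Proof.
move=> d2; pose A : 'M[R]_(1 + 1, d) := col_mx x y.
have : kermx A^T != 0.
  rewrite -mxrank_eq0 mxrank_ker -lt0n subn_gt0.
  by apply: leq_ltn_trans (rank_leq_col _) _.
move/rowV0Pn => [w /sub_kermxP wA w0]; exists w; split => //.
  have /matrixP/(_ ord0 (lshift 1 ord0)) := wA.
  rewrite !mxE => <-; apply: eq_bigr => i _.
  by rewrite mxE col_mxEu.
have /matrixP/(_ ord0 (rshift 1 ord0)) := wA.
rewrite !mxE => <-; apply: eq_bigr => i _.
by rewrite mxE col_mxEd.
Qed.

(* The points (1, t, ..., t^(d-1)) avoid any finite union of hyperplanes for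
   some t, since a nonzero polynomial has finitely many roots. *)
Lemma exists_off_hyperplanes n (w : 'I_n -> 'rV[R]_d) :
  (forall i, w i != 0) -> exists v, forall i, rVdot (w i) v != 0.
Proof.
move=> w0; pose p i : {poly R} := \sum_(k < d) w i ord0 k *: 'X^k.
have p0 i : p i != 0.
  apply: contra_neq (w0 i) => pi0; apply/rowP => k; rewrite mxE.
  have := congr1 (fun q : {poly R} => q`_k) pi0; rewrite coef0 coef_sum (bigD1 k)//=.
  rewrite coefZ coefXn eqxx mulr1 big1 ?addr0// => l lk.
  by rewrite coefZ coefXn eq_sym val_eqE (negbTE lk) mulr0.
have P0 : \prod_i p i != 0 by apply/prodf_neq0.
have [t Pt] : exists t : R, (\prod_i p i).[t] != 0.
  (* Otherwise 0, 1, ..., size - 1 would all be roots, more than the degree permits. *)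
  apply: contrapT => h; pose rs := [seq k%:R : R | k <- iota 0 (size (\prod_i p i))].
  suff : (size rs < size (\prod_i p i)%R)%N by rewrite size_map size_iota ltnn.
  apply: max_poly_roots => //.
    by apply/allP => t _; apply/negPn/negP => ht; apply: h; exists t.
  by rewrite map_inj_uniq ?iota_uniq// => k l /eqP; rewrite eqr_nat => /eqP.
exists (\row_k t ^+ k) => i.
move: Pt; rewrite horner_prod => /prodf_neq0 /(_ i isT).
rewrite horner_sum; apply: contra_neq => wt.
rewrite -[RHS]wt; apply: eq_bigr => k _.
by rewrite hornerZ hornerXn mxE.
Qed.

Lemma linform_isotropic a b x :
  linform (fun i => Complex (a ord0 i) (b ord0 i)) x = Complex (rVdot a x) (rVdot b x).
Proof.
apply: complex_eqP.
  rewrite /linform Rec_sum; apply: eq_bigr => i _.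
  by rewrite RecM /= mulr0 subr0.
rewrite /linform Imc_sum; apply: eq_bigr => i _.
by rewrite ImcM /= mulr0 add0r.
Qed.

(** For u = a + i b, the real part of u.u is |a|^2 - |b|^2 and the imaginary part is 2 a.b. *)
Lemma isotropic_complex a b : rVdot a a = 1 -> rVdot b b = 1 -> rVdot a b = 0 ->
  \sum_i (Complex (a ord0 i) (b ord0 i)) ^+ 2 = 0 :> C.
Proof.
move=> aa bb ab; apply: complex_eqP.
  rewrite Rec_sum -[RHS](subrr 1) -{1}aa -bb -sumrB.
  by apply: eq_bigr => i _; rewrite expr2 RecM.
transitivity (2 * rVdot a b); last by rewrite ab mulr0.
rewrite Imc_sum mulr_sumr.
by apply: eq_bigr => i _; rewrite expr2 ImcM /=; ring.
Qed.

(* A generic great circle through [x i0] contains no other of the points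
   except possibly the antipode; this is where [2 < d] is needed. *)
Lemma exists_separating_isotropic n (x : 'I_n -> 'rV[R]_d) i0 : (2 < d)%N ->
  (forall i, sphere (x i)) ->
  exists u : 'I_d -> C, [/\ \sum_i u i ^+ 2 = 0, linform u (x i0) = 1 &
    forall i, x i != x i0 -> x i != - x i0 ->
      ComplexField.Normc.normc (linform u (x i)) < 1].
Proof.
move=> d2 xS; set a := x i0.
have aa : rVdot a a = 1 by rewrite rVdotxx; apply/sphereE; exact: xS.
(* Each w i is orthogonal to a and to x i. A vector v off all the hyperplanes orthogonal to the w i,
   made orthogonal to a and normalised, gives b with (w i).b != 0. If x i lies in the plane of a and
   b, pairing with w i shows that its b-coordinate is 0, so x i is a or -a. *)
have /choice[w hw] i : exists w, [/\ w != 0, rVdot w a = 0 & rVdot w (x i) = 0].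
  exact: exists_orthogonal_functional.
have [v wv] := @exists_off_hyperplanes n w (fun i => let: And3 h _ _ := hw i in h).
pose c := v + (- rVdot a v) *: a.
have wc i : rVdot (w i) c = rVdot (w i) v.
  by have [_ wa _] := hw i; rewrite rVdotDr rVdotZr wa mulr0 addr0.
have ac : rVdot a c = 0 by rewrite rVdotDr rVdotZr aa mulr1 subrr.
have c0 : c != 0.
  apply: contra_neq (wv i0) => c0; rewrite -wc c0.
  by rewrite rVdotx0.
have ec : enorm c != 0.
  apply: contra_neq c0 => c0; apply: sqnorm_eq0.
  by rewrite -sqr_enorm c0 expr0n.
pose b := (enorm c)^-1 *: c.
have bb : rVdot b b = 1.
  rewrite rVdotZl rVdotZr rVdotxx -sqr_enorm.
  by field.
have ab : rVdot a b = 0 by rewrite rVdotZr ac mulr0.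
have wb i : rVdot (w i) b != 0 by rewrite rVdotZr wc mulf_neq0 ?invr_neq0.
clearbody b.
exists (fun i => Complex (a ord0 i) (b ord0 i)); split.
- exact: isotropic_complex.
- by rewrite linform_isotropic aa rVdotC ab.
move=> i xa xNa; rewrite linform_isotropic.
(* The component of x i orthogonal to the plane of a and b: |y|^2 = 1 - |u.x_i|^2, so the strict
   inequality amounts to y != 0. *)
pose y := x i + (- rVdot a (x i)) *: a + (- rVdot b (x i)) *: b.
have xx : rVdot (x i) (x i) = 1 by rewrite rVdotxx; apply/sphereE; exact: xS.
have yy : sqnorm y = 1 - (rVdot a (x i) ^+ 2 + rVdot b (x i) ^+ 2).
  rewrite -rVdotxx /y !(rVdotDl, rVdotDr, rVdotZl, rVdotZr) xx aa bb.
  rewrite (rVdotC (x i) a) (rVdotC (x i) b) (rVdotC b a) ab.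
  ring.
rewrite /= -[ltRHS]sqrtr1 ltr_sqrt// -subr_gt0 -yy lt_neqAle sqnorm_ge0 andbT.
apply/eqP => /esym/sqnorm_eq0 y0.
have [_ wa wx] := hw i.
have /eqP : rVdot (w i) y = 0 by rewrite y0 rVdotx0.
rewrite /y !rVdotDr !rVdotZr wx wa mulr0 !add0r mulf_eq0 (negbTE (wb i)) orbF.
rewrite oppr_eq0 => /eqP bx.
have xE : x i = rVdot a (x i) *: a.
  by apply/eqP; rewrite -subr_eq0 -scaleNr; move: y0; rewrite /y bx oppr0 scale0r addr0 => ->.
have : rVdot a (x i) ^+ 2 = 1.
  move: yy; rewrite y0 -rVdotxx rVdotx0 bx expr0n addr0 => /eqP.
  by rewrite eq_sym subr_eq0 => /eqP.
move/eqP; rewrite sqrf_eq1 => /orP[]/eqP ax; move: xE; rewrite ax.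
  by rewrite scale1r => /eqP; rewrite (negbTE xa).
by rewrite scaleN1r => /eqP; rewrite (negbTE xNa).
Qed.

End IsotropicHarmonics.

(** * Point functionals vanishing on infinitely many even and odd degrees *)

Section Unisolvence.
Context (R : realType) (d : nat).
Local Notation C := R[i].
Local Notation normc := (@ComplexField.Normc.normc R).

Lemma infinite_nat_ge (A : set nat) N : infinite_set A ->
  exists2 j, A j & (N <= j)%N.
Proof.
move=> Ainf; apply: contrapT => h; apply: Ainf.
apply: (sub_finite_set _ (finite_II N)) => j Aj /=.
by rewrite ltnNge; apply/negP => Nj; apply: h; exists j.
Qed.

Lemma normr_normc (z : C) : `|z| = (normc z)%:C%C.
Proof. by []. Qed.

(** For j in A, |z| is at most a finite combination of |l i|^j, which tends to 0; A contains
    arbitrarily large j. *)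
Lemma eq0_geometric_bound (I : finType) (Q : pred I) (c l : I -> C) (A : set nat)
    (z : C) : infinite_set A ->
  (forall i, Q i -> normc (l i) < 1) ->
  (forall j, A j -> z + \sum_(i | Q i) c i * l i ^+ j = 0) -> z = 0.
Proof.
move=> Ainf l1 Az.
pose u (j : nat) : R := \sum_(i | Q i) normc (c i) * normc (l i) ^+ j.
have u0 : u j @[j --> \oo] --> 0.
  have -> : 0 = \sum_(i | Q i) 0 :> R by rewrite big1.
  apply: cvg_big => [|i Qi]; first exact: add_continuous.
  apply: cvg_geometric; rewrite ger0_norm ?l1//.
  by rewrite -lecR; exact: (normr_ge0 (l i)).
have zu j : A j -> normc z <= u j.
  move=> /Az/eqP; rewrite addr_eq0 => /eqP ->; rewrite -lecR.
  have -> : (normc (- \sum_(i | Q i) c i * l i ^+ j))%:C%C =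
      `|\sum_(i | Q i) c i * l i ^+ j| by rewrite -normrN.
  apply: le_trans (ler_norm_sum _ _ _) _.
  rewrite rmorph_sum; apply: ler_sum => i _.
  by rewrite normrM normrX rmorphM rmorphXn.
apply/eqP; rewrite -normr_le0 normr_normc lecR leNgt; apply/negP => z0.
move/cvgrPdist_lt : u0 => /(_ _ z0)[N _ uN].
have [j Aj Nj] := infinite_nat_ge N Ainf.
have := uN j Nj; rewrite sub0r normrN => /(le_lt_trans (ler_norm _)).
by rewrite ltNge zu.
Qed.

Lemma linformN (u : 'I_d -> C) x : linform u (- x) = - linform u x.
Proof.
rewrite -sumrN; apply: eq_bigr => i _; rewrite mxE -mulrN.
by rewrite rmorphN.
Qed.

(** Testing on (u.x)^j leaves c_i0 + (-1)^j b plus geometrically decaying terms, where b is the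
    contribution of the antipode. Even j give c_i0 + b = 0 and odd j give c_i0 - b = 0. *)
Lemma harmonic_unisolvence n (x : 'I_n -> 'rV[R]_d) (c : 'I_n -> C) (F : set nat) :
  (2 < d)%N -> injective x -> (forall i, sphere (x i)) ->
  infinite_set (F `&` [set j | ~~ odd j]) ->
  infinite_set (F `&` [set j | odd j]) ->
  (forall j f, F j -> spherical_harmonic j f -> \sum_i c i * f (x i) = 0) ->
  forall i, c i = 0.
Proof.
move=> d2 xinj xS Feven Fodd cF i0.
have [u [u0 u1 ul]] := exists_separating_isotropic i0 d2 xS.
pose Q := [pred i | (x i != x i0) && (x i != - x i0)].
(* By injectivity at most one term occurs: b is the coefficient at the antipode, or 0 if the
   antipode is not among the points. *)
pose b := \sum_(i | x i == - x i0) c i.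
have xNx : x i0 != - x i0.
  apply: contraTneq isT => xN; have : linform u (x i0) = - linform u (x i0).
    by rewrite -linformN -xN.
  by rewrite u1 => /eqP; rewrite -subr_eq0 opprK (_ : 1 + 1 = 2%:R)// pnatr_eq0.
have sumE j : F j -> c i0 + (-1) ^+ j * b + \sum_(i | Q i) c i * linform u (x i) ^+ j = 0.
  move=> Fj; have := cF j _ Fj (spherical_harmonic_isotropic j u0).
  rewrite (bigD1 i0)//= u1 expr1n mulr1 => h; apply: etrans h; rewrite -addrA; congr (_ + _).
  rewrite [RHS](bigID (fun i => x i == - x i0))/=; congr (_ + _).
    rewrite mulr_sumr; apply: eq_big => [i|i /eqP xi].
      case: eqP => [xi|]; rewrite ?andbF//= andbT; apply/esym.
      by apply: contraNneq xNx => ii; rewrite -xi ii.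
    by rewrite xi linformN u1 mulrC.
  by apply: eq_bigl => i; rewrite /Q /= (inj_eq xinj).
have e0 : c i0 + b = 0.
  apply: (eq0_geometric_bound Feven (c := c) (l := fun i => linform u (x i)) (Q := Q)).
    by move=> i /andP[? ?]; exact: ul.
  by move=> j [Fj /= /negbTE jodd]; have := sumE j Fj; rewrite -signr_odd jodd mul1r.
have o0 : c i0 - b = 0.
  apply: (eq0_geometric_bound Fodd (c := c) (l := fun i => linform u (x i)) (Q := Q)).
    by move=> i /andP[? ?]; exact: ul.
  by move=> j [Fj /= jodd]; have := sumE j Fj; rewrite -signr_odd jodd mulN1r.
have : c i0 *+ 2 = 0.
  by transitivity ((c i0 + b) + (c i0 - b)); [ring|rewrite e0 o0 addr0].
by move/eqP; rewrite mulrn_eq0 => /eqP.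
Qed.

End Unisolvence.

(** * Semidefinite hermitian forms *)

Section PositiveSemidefinite.
Context (R : realType).
Local Notation C := R[i].

(** Conjugate linear in u; on the diagonal it is the quadratic form of [psd_mx] and [pd_mx]. *)
Definition hform n (A : 'M[C]_n) (u v : 'cV[C]_n) : C :=
  (map_mx Num.conj u^T *m A *m v) ord0 ord0.

Lemma hformE n (A : 'M[C]_n) u v :
  hform A u v = \sum_k (\sum_i (u i ord0)^* * A i k) * v k ord0.
Proof.
rewrite /hform mxE; apply: eq_bigr => k _; rewrite mxE; congr (_ * _).
by apply: eq_bigr => i _; rewrite !mxE.
Qed.

Lemma hform_delta n (A : 'M[C]_n) u k :
  hform A u (delta_mx k ord0) = \sum_i (u i ord0)^* * A i k.
Proof.
rewrite hformE (bigD1 k)//= mxE !eqxx mulr1 [X in _ + X]big1 ?addr0// => l lk.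
by rewrite mxE (negbTE lk) mulr0.
Qed.

Lemma hformDl n (A : 'M[C]_n) u v w : hform A (u + v) w = hform A u w + hform A v w.
Proof. by rewrite /hform linearD map_mxD !mulmxDl mxE. Qed.

Lemma hformDr n (A : 'M[C]_n) u v w : hform A w (u + v) = hform A w u + hform A w v.
Proof. by rewrite /hform mulmxDr mxE. Qed.

Lemma hformZr n (A : 'M[C]_n) z u v : hform A u (z *: v) = z * hform A u v.
Proof. by rewrite /hform -scalemxAr mxE. Qed.

Lemma hformZl n (A : 'M[C]_n) z u v : hform A (z *: u) v = z^* * hform A u v.
Proof. by rewrite /hform linearZ /= map_mxZ -!scalemxAl mxE. Qed.

Lemma hform_conj n (A : 'M[C]_n) u v : A \is hermsymmx ->
  hform A v u = (hform A u v)^*.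
Proof.
move=> /is_hermitianmxP; rewrite expr0 scale1r => AE.
rewrite !hformE rmorph_sum /=.
under eq_bigr do rewrite mulr_suml.
rewrite exchange_big /=; apply: eq_bigr => k _.
rewrite rmorphM rmorph_sum /= mulr_suml; apply: eq_bigr => i _.
have -> : A k i = (A i k)^* by rewrite {1}AE !mxE.
by rewrite rmorphM /= conjCK; ring.
Qed.

(** The degenerate case of Cauchy-Schwarz. With z = A(u, v), q = A(v, v) and s = 1/(q + 1), the form
    at u - s conj(z) v equals -s |z|^2 (2 - s q). It is nonnegative while s q < 2, so z = 0. *)
Lemma psd_mx_kernel n (A : 'M[C]_n) u v : psd_mx A -> hform A u u = 0 -> hform A u v = 0.
Proof.
move=> [hA A0] u0; have q0 : 0 <= hform A v v := A0 v.
set z := hform A u v.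
pose s := (hform A v v + 1)^-1.
have s0 : 0 < s by rewrite invr_gt0 ltr_wpDl.
have sr : s^* = s by apply/CrealP; rewrite realE ltW.
have := A0 (u + (- s * z^*) *: v); rewrite -/(hform _ _ _).
rewrite !hformDl !hformDr !hformZl !hformZr u0 (hform_conj u v hA) -/z.
rewrite rmorphM rmorphN /= sr conjCK add0r.
rewrite (_ : _ + _ = - (s * `|z| ^+ 2) * (2 - s * hform A v v)); last first.
  by rewrite normCK; ring.
rewrite mulNr oppr_ge0 pmulr_lle0.
  rewrite pmulr_rle0// => z0; apply/eqP; rewrite -normr_eq0 -sqrf_eq0 eq_le z0.
  exact: exprn_ge0.
rewrite subr_gt0 /s mulrC ltr_pdivrMr ?ltr_wpDl//.
by rewrite mulrDr mulr1 ltr_pwDr ?ltr0n// ler_peMl// ler1n.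
Qed.

End PositiveSemidefinite.

(** * Strict positive definiteness *)

Section KernelNullSpace.
Context (R : realType) (d : nat).
Local Notation C := R[i].
Implicit Types (K : 'rV[R]_d -> 'rV[R]_d -> C).

(** If y is one of the points, the null vector is paired with a basis vector. Otherwise y is added
    to the points with coefficient 0, which keeps the vector null for the larger matrix. *)
Lemma kernel_null_vector K n (x : 'I_n -> 'rV[R]_d) (c : 'cV[C]_n) :
  positive_definite_kernel K -> injective x -> (forall i, sphere (x i)) ->
  hform (kernel_mx K x) c c = 0 ->
  forall y, sphere y -> \sum_i (c i ord0)^* * K (x i) y = 0.
Proof.
move=> [_ pdK] xinj xS c0 y yS.
have [[i0 yx]|yx] := pselect (exists i, y = x i).
  have := psd_mx_kernel (delta_mx i0 ord0) (pdK n x xinj xS) c0.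
  rewrite hform_delta => h; apply: etrans h.
  by apply: eq_bigr => i _; rewrite mxE yx.
pose x' (i : 'I_n.+1) := oapp x y (unlift ord0 i).
pose c' : 'cV[C]_n.+1 := \col_i oapp (fun k => c k ord0) 0 (unlift ord0 i).
have x'0 : x' ord0 = y by rewrite /x' unlift_none.
have x'S i : x' (lift ord0 i) = x i by rewrite /x' liftK.
have c'0 : c' ord0 ord0 = 0 by rewrite mxE unlift_none.
have c'S i : c' (lift ord0 i) ord0 = c i ord0 by rewrite mxE liftK.
have x'inj : injective x'.
  move=> i k; case: (unliftP ord0 i) => [i'|] ->; case: (unliftP ord0 k) => [k'|] ->//.
  - by rewrite !x'S => /xinj ->.
  - by rewrite x'0 x'S => e; exfalso; apply: yx; exists i'.
  - by rewrite x'0 x'S => e; exfalso; apply: yx; exists k'.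
have x'sph i : sphere (x' i).
  by case: (unliftP ord0 i) => [i'|] ->; rewrite ?x'S ?x'0.
have sumE k : \sum_i (c' i ord0)^* * kernel_mx K x' i k = \sum_i (c i ord0)^* * K (x i) (x' k).
  rewrite big_ord_recl c'0 conjC0 mul0r add0r.
  by apply: eq_bigr => i _; rewrite c'S mxE x'S.
have q0 : hform (kernel_mx K x') c' c' = 0.
  rewrite -c0 !hformE big_ord_recl c'0 mulr0 add0r; apply: eq_bigr => k _.
  rewrite sumE c'S x'S; congr (_ * _).
  by apply: eq_bigr => i _; rewrite mxE.
have := psd_mx_kernel (delta_mx ord0 ord0) (pdK _ x' x'inj x'sph) q0.
by rewrite hform_delta sumE x'0.
Qed.

(** The form conjugates its first argument, so it is evaluated at conj(w): the inner sums are the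
    given ones, and the value is 0. *)
Lemma pd_mx_row0 n (A : 'M[C]_n) (w : 'I_n -> C) : pd_mx A ->
  (forall k, \sum_i w i * A i k = 0) -> forall i, w i = 0.
Proof.
move=> [_ pA] wA.
have [v0|v0] := eqVneq (\col_i (w i)^*) 0.
  move=> i; have /matrixP/(_ i ord0) := v0; rewrite !mxE => /eqP.
  by rewrite conjC_eq0 => /eqP.
have := pA _ v0; rewrite -/(hform A _ _) hformE big1 ?ltxx// => k _.
rewrite (_ : \sum_i _ = 0) ?mul0r// -[RHS](wA k).
by apply: eq_bigr => i _; rewrite mxE conjCK.
Qed.

End KernelNullSpace.

Theorem theorem4 (R : realType) (d : nat)
    (K : 'rV[R]_d -> 'rV[R]_d -> R[i])
    (Y : forall j : nat, 'I_(harmonic_dim d j) -> 'rV[R]_d -> R[i])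
    (D : forall j : nat, 'M[R[i]]_(harmonic_dim d j)) :
  (2 < d)%N ->
  continuous_kernel K ->
  positive_definite_kernel K ->
  (forall j : nat, orthonormal_harmonic_basis (Y j)) ->
  harmonic_expansion K Y D ->
  let F := [set j : nat | pd_mx (D j)] in
  infinite_set (F `&` [set j : nat | ~~ odd j]) ->
  infinite_set (F `&` [set j : nat | odd j]) ->
  strictly_positive_definite_kernel K.
Proof.
move=> d2 cK pdK onY KE F Feven Fodd; split; first by case: pdK.
move=> n x xinj xS; have [hA A0] := pdK.2 n x xinj xS; split=> // c c0.
(* Semidefiniteness is known, so it remains to derive c = 0 from the vanishing of the form at c. *)
rewrite lt_def A0 andbT -/(hform _ c c); apply: contra_neq c0 => q0.
apply/colP => i; rewrite mxE; apply/eqP; rewrite -conjC_eq0; apply/eqP; move: i.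
(* Applied to the coefficients conj(c_i), which is why c was conjugated just before. *)
apply: (harmonic_unisolvence d2 xinj xS Feven Fodd) => j f Fj hf.
have [_ _ Yspan] := onY j; have [b fE] := Yspan f hf.
have null := kernel_null_vector pdK xinj xS q0.
pose w k := \sum_i (c i ord0)^* * Y j k (x i).
have w0 : forall k, w k = 0.
  apply: (pd_mx_row0 Fj) => k'.
  (* Each column sum of w against D_j is rewritten through the coefficient formula as the integral
     of (sum_i conj(c_i) K(x_i, .)) Y_j^k', whose first factor vanishes on the sphere. *)
  transitivity (\sum_i (c i ord0)^* * sphere_int (fun y => K (x i) y * Y j k' y)).
    under [RHS]eq_bigr do rewrite (kernel_coefficient cK onY KE)// mulr_sumr.
    rewrite exchange_big /=; apply: eq_bigr => k _.
    by rewrite mulr_suml; apply: eq_bigr => i _; ring.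
  have cKY i : sphere_ccontinuous (fun y => K (x i) y * Y j k' y).
    apply: ccontinuousM; first exact: (ccontinuous_kernel_section cK (xS i)).
    exact: ccontinuous_basis.
  under eq_bigr do rewrite -sphere_intZ//.
  rewrite -sphere_int_sum => [|i]; last first.
    by apply: ccontinuousM; [exact: ccontinuous_cst|exact: cKY].
  rewrite -[RHS](@sphere_int0 R d); apply: eq_sphere_int => y yS.
  transitivity ((\sum_i (c i ord0)^* * K (x i) y) * Y j k' y).
    by rewrite mulr_suml; apply: eq_bigr => i _; ring.
  by rewrite null// mul0r.
(* Expanding f in the basis of degree j expresses the functional at f through the values w k. *)
under eq_bigr do rewrite fE// mulr_sumr.
rewrite exchange_big big1 //= => k _.
transitivity (b k * w k); last by rewrite w0 mulr0.
by rewrite mulr_sumr; apply: eq_bigr => i _; ring.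
Qed.
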